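(* Let $G$ be a finite group and $H$ a subgroup of $G$. The natural maps $\eta_{\underline R}:\underline R\to\mathrm{Res}_H^GsN^{G,H}\underline R$ (for $\underline R$ an $H$-semi-Tambara functor), given for a finite $H$-set $X$ and $u\in\underline R(X)$ by $$u\mapsto(G\times_HX\xrightarrow{=}G\times_HX,\ n_{\eta_X}(u)),$$ and $\epsilon_{\underline R}:sN^{G,H}\mathrm{Res}_H^G\underline R\to\underline R$ (for $\underline R$ a $G$-semi-Tambara functor), given for a finite $G$-set $X$ by $$(V\xrightarrow jX,u)\mapsto t_jn_{\epsilon_V}(u),$$ are the unit and counit, respectively, of an adjunction $(sN^{G,H},\mathrm{Res}_H^G)$ between the category $\mathrm{sTamb}(H)$ of $H$-semi-Tambara functors and the category $\mathrm{sTamb}(G)$ of $G$-semi-Tambara functors ($sN^{G,H}$ being the left adjoint).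
   Context: $\mathrm{Fin}_G$ is the category of finite $G$-sets. Exponential diagrams: for $i:X\to Y$, $j:Y\to Z$ in $\mathrm{Fin}_G$ let $\prod_{i,j}X=\{(z,s): z\in Z,\ s:j^{-1}(z)\to X,\ i\circ s=\mathrm{Id}\}$ (conjugation action), $p(z,s)=z$, $e:Y\times_Z\prod_{i,j}X\to X$, $e(y,(z,s))=s(y)$. A triple $(f:A\to X,g:A\to B,h:B\to Z)$ isomorphic to $(e,\pi_2,p)$ is a distributor for $(i,j)$. A semi-Tambara functor over $G$ is a triple of functors $\underline M^*:\mathrm{Fin}_G^{op}\to\mathrm{Set}_{\ne\emptyset}$, $\underline M_*,\underline M_\star:\mathrm{Fin}_G\to\mathrm{Set}_{\neq\emptyset}$ (nonempty sets) with common object assignment $X\mapsto\underline M(X)$; write $r_f=\underline M^*(f)$, $t_f=\underline M_*(f)$, $n_f=\underline M_\star(f)$. One requires: $\underline M^*$ takes coproducts to products; for pullback squares with $p:P\to X$, $q:P\to Y$, $i:Y\to Z$, $j:X\to Z$, $r_jt_i=t_pr_q$ and $r_jn_i=n_pr_q$; and for each distributor $(f,g,h)$ for $(i,j)$, $n_jt_i=t_hn_gr_f$. Morphisms are collections of functions natural for all three structures. Restriction: $(\mathrm{Res}_H^G\underline R)(X)=\underline R(G\times_HX)$, with $r_f,t_f,n_f$ given by those of $\underline R$ along $G\times_Hf$. $\eta_X:X\to\mathrm{Res}_H^G(G\times_HX)$, $x\mapsto[1,x]$, and $\epsilon_V:G\times_H\mathrm{Res}_H^GV\to V$, $[g,v]\mapsto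 gv$, are the unit and counit of the induction/restriction adjunction on sets. $G\times_H\mathrm{Res}_H^GV$ is identified with $G/H\times V$ by $[g,v]\mapsto(gH,gv)$. In the formula for $\epsilon_{\underline R}$, $u\in\mathrm{Res}_H^G\underline R(\mathrm{Res}_H^GV)=\underline R(G\times_H\mathrm{Res}_H^GV)$. Definition of $sN^{G,H}$: for $\underline R\in\mathrm{sTamb}(H)$ and $X\in\mathrm{Fin}_G$, $sN_0^{G,H}\underline R(X)$ is the set of isomorphism classes of pairs $(V\xrightarrow jX,u)$ with $j$ in $\mathrm{Fin}_G$ and $u\in\underline R(\mathrm{Res}_H^GV)$, where $(V,j,u)\cong(V',j',u')$ iff there is an isomorphism $f:V'\to V$ over $X$ with $r_{\mathrm{Res}_H^Gf}(u)=u'$. $sN^{G,H}\underline R(X)$ is the quotient by the smallest equivalence relation with $(V\xrightarrow jX,t_f(w))\sim(D_H(W,f,V)\xrightarrow{j\circ p}X,r_{e_H}(w))$ for all $H$-maps $f:W\to\mathrm{Res}_H^GV$ and $w\in\underline R(W)$, where $(G\times_He_H:G/H\times D_H(W,f,V)\to G\times_HW,\ \pi_2,\ p:D_H(W,f,V)\to V)$ is a distributor for $(G\times_Hf:G\times_HW\to G/H\times V,\ \pi_2:G/H\times V\to V)$. Transfers are by composition, restrictions by pullback, and for $f:X\to Y$ the norm is $n_f(V\xrightarrow jX,u)=(D\xrightarrow pY,\ n_{\mathrm{Res}_H^Gk}r_{\mathrm{Res}_H^Ge}(u))$, where $(e:E\to V,k:E\to D,p:D\to Y)$ is a distributor for $(j,f)$.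 These make $sN^{G,H}\underline R$ a $G$-semi-Tambara functor. *)

(* Defs.v *)
From HB Require Import structures.
From mathcomp Require Import all_boot all_fingroup.
From mathcomp Require Import boolp.
From Stdlib Require Import Relation_Operators.

Set Implicit Arguments.
Unset Strict Implicit.
Unset Printing Implicit Defensive.

Local Open Scope group_scope.
Local Open Scope quotient_scope.

Record category := Category {
  cat_ob :> Type;
  hom : cat_ob -> cat_ob -> Type;
  idc : forall A, hom A A;
  compc : forall A B C, hom B C -> hom A B -> hom A C;
  compc1 : forall A B (f : hom A B), compc f (idc A) = f;
  comp1c : forall A B (f : hom A B), compc (idc B) f = f;
  compcA : forall A B C D (f : hom C D) (g : hom B C) (h : hom A B),
    compc f (compc g h) = compc (compc f g) h }.

Arguments idc {_} A.

Record functor (C D : category) := Functor {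
  fob :> C -> D;
  fhom : forall A B : C, hom A B -> hom (fob A) (fob B);
  fhom_id : forall A : C, fhom (idc A) = idc (fob A);
  fhom_comp : forall (A B E : C) (f : hom B E) (g : hom A B),
    fhom (compc f g) = compc (fhom f) (fhom g) }.

Definition idfunctor (C : category) : functor C C :=
  @Functor C C id (fun _ _ f => f) (fun _ => erefl) (fun _ _ _ _ _ => erefl).

Lemma comp_fhom_id (C D E : category) (F : functor D E) (F' : functor C D)
  (A : C) : fhom F (fhom F' (idc A)) = idc (F (F' A)).
Proof. by rewrite !fhom_id. Qed.

Lemma comp_fhom_comp (C D E : category) (F : functor D E) (F' : functor C D)
  (A B K : C) (f : hom B K) (g : hom A B) :
  fhom F (fhom F' (compc f g)) =
  compc (fhom F (fhom F' f)) (fhom F (fhom F' g)).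
Proof. by rewrite !fhom_comp. Qed.

Definition comp_functor (C D E : category) (F : functor D E)
    (F' : functor C D) : functor C E :=
  @Functor C E (fun A => F (F' A)) (fun A B f => fhom F (fhom F' f))
    (comp_fhom_id F F') (@comp_fhom_comp _ _ _ F F').

Record nattrans (C D : category) (F F' : functor C D) := NatTrans {
  ncomp :> forall A : C, hom (F A) (F' A);
  nat_sq : forall (A B : C) (f : hom A B),
    compc (ncomp B) (fhom F f) = compc (fhom F' f) (ncomp A) }.

Definition is_adjunction (C D : category) (L : functor C D) (R : functor D C)
    (eta : nattrans (idfunctor C) (comp_functor R L))
    (eps : nattrans (comp_functor L R) (idfunctor D)) : Prop :=
  (forall A : C, compc (eps (L A)) (fhom L (eta A)) = idc (L A)) /\
  (forall B : D, compc (fhom R (eps B)) (eta (R B)) = idc (R B)).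

(* MathComp's actions are right actions; the G-sets here are left G-sets. *)
Record gset (gT : finGroupType) := GSet {
  gcar :> finType;
  gact : gT -> gcar -> gcar;
  gact1 : forall x, gact 1 x = x;
  gactM : forall a b x, gact (a * b) x = gact a (gact b x) }.

Record gmap (gT : finGroupType) (X Y : gset gT) := GMap {
  gfun :> X -> Y;
  gmapE : forall a x, gfun (gact a x) = gact a (gfun x) }.

Section FiniteGSets.
Variable gT : finGroupType.
Implicit Types X Y Z V A B P : gset gT.

Lemma gmap_eq X Y (f g : gmap X Y) : f =1 g -> f = g.
Proof.
case: f g => f fE [g gE] /= /funext efg; rewrite {}efg in fE *.
by congr GMap; apply: Prop_irrelevance.
Qed.

Lemma gactK X (a : gT) : cancel (@gact _ X a) (@gact _ X a^-1).
Proof. by move=> x; rewrite -gactM mulVg gact1. Qed.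

Lemma gactKV X (a : gT) : cancel (@gact _ X a^-1) (@gact _ X a).
Proof. by move=> x; rewrite -gactM mulgV gact1. Qed.

Definition gid X : gmap X X := @GMap _ X X id (fun _ _ => erefl).

Lemma gcomp_subproof X Y Z (g : gmap Y Z) (f : gmap X Y) a x :
  g (f (gact a x)) = gact a (g (f x)).
Proof. by rewrite !gmapE. Qed.

Definition gcomp X Y Z (g : gmap Y Z) (f : gmap X Y) : gmap X Z :=
  GMap (gcomp_subproof g f).

Definition gempty : gset gT :=
  @GSet gT void (fun _ x => x) (fun _ => erefl) (fun _ _ _ => erefl).

Definition gsum_act X Y (a : gT) (w : X + Y) : X + Y :=
  match w with inl x => inl (gact a x) | inr y => inr (gact a y) end.

Lemma gsum_act1 X Y (w : X + Y) : gsum_act 1 w = w.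
Proof. by case: w => w /=; rewrite gact1. Qed.

Lemma gsum_actM X Y a b (w : X + Y) :
  gsum_act (a * b) w = gsum_act a (gsum_act b w).
Proof. by case: w => w /=; rewrite gactM. Qed.

Definition gsum X Y : gset gT := GSet (@gsum_act1 X Y) (@gsum_actM X Y).

Definition ginl X Y : gmap X (gsum X Y) :=
  @GMap _ X (gsum X Y) inl (fun _ _ => erefl).

Definition ginr X Y : gmap Y (gsum X Y) :=
  @GMap _ Y (gsum X Y) inr (fun _ _ => erefl).

Definition is_pullback P X Y Z (p : gmap P X) (q : gmap P Y)
    (i : gmap Y Z) (j : gmap X Z) : Prop :=
  gcomp j p = gcomp i q /\
  forall T (a : gmap T X) (b : gmap T Y), gcomp j a = gcomp i b ->
    exists! c : gmap T P, gcomp p c = a /\ gcomp q c = b.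

Section FiberProduct.
Variables (X Y Z : gset gT) (i : gmap X Z) (j : gmap Y Z).

Definition fp_car : finType := {xy : X * Y | i xy.1 == j xy.2}.

Lemma fp_act_subproof (a : gT) (w : fp_car) :
  i (gact a (val w).1) == j (gact a (val w).2).
Proof. by rewrite !gmapE (eqP (valP w)). Qed.

Definition fp_act (a : gT) (w : fp_car) : fp_car :=
  exist _ (gact a (val w).1, gact a (val w).2) (fp_act_subproof a w).

Lemma fp_act1 w : fp_act 1 w = w.
Proof. by apply: val_inj; case: w => -[x y] e /=; rewrite !gact1. Qed.

Lemma fp_actM a b w : fp_act (a * b) w = fp_act a (fp_act b w).
Proof. by apply: val_inj => /=; rewrite !gactM. Qed.

Definition fprod : gset gT := GSet fp_act1 fp_actM.

Definition fp1 : gmap fprod X :=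
  @GMap _ fprod X (fun w => (val w).1) (fun _ _ => erefl).

Definition fp2 : gmap fprod Y :=
  @GMap _ fprod Y (fun w => (val w).2) (fun _ _ => erefl).

End FiberProduct.

Section DependentProduct.
Variables (X Y Z : gset gT) (i : gmap X Y) (j : gmap Y Z).

Definition fiber (z : Z) : finType := {y : Y | j y == z}.

Definition sections (z : Z) : finType :=
  {s : {ffun fiber z -> X} | [forall y, i (s y) == val y]}.

Definition dp_car : finType := {z : Z & sections z}.

Lemma sectionE z (s : sections z) y : i (val s y) = val y.
Proof. exact/eqP/(forallP (valP s)). Qed.

Lemma fiberE z (y : fiber z) : j (val y) = z.
Proof. exact/eqP/(valP y). Qed.

Lemma dp_eq (u v : dp_car) : tag u = tag v ->
  (forall y pu pv, val (tagged u) (exist _ y pu) =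
                   val (tagged v) (exist _ y pv)) -> u = v.
Proof.
case: u v => z s [z' s'] /= e; case: _ / e s' => s' ess.
by congr existT; apply/val_inj/ffunP => -[y p]; apply: ess.
Qed.

Lemma fiber_act_subproof (a : gT) z (y : fiber (gact a z)) :
  j (gact a^-1 (val y)) == z.
Proof. by rewrite gmapE (eqP (valP y)) gactK. Qed.

Definition fiber_act (a : gT) z (y : fiber (gact a z)) : fiber z :=
  exist _ (gact a^-1 (val y)) (fiber_act_subproof y).

Definition dp_act_fun (a : gT) z (s : sections z) :
    {ffun fiber (gact a z) -> X} :=
  [ffun y => gact a (val s (fiber_act y))].

Lemma dp_act_subproof a z (s : sections z) :
  [forall y, i (dp_act_fun a s y) == val y].
Proof.
by apply/forallP => y; rewrite ffunE gmapE sectionE /= gactKV.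
Qed.

Definition dp_act_section (a : gT) z (s : sections z) : sections (gact a z) :=
  Sub (dp_act_fun a s) (dp_act_subproof a s).

Definition dp_act (a : gT) (u : dp_car) : dp_car :=
  existT sections (gact a (tag u)) (dp_act_section a (tagged u)).

Lemma val_section_eq z (s : sections z) y y' (p : j y == z) (p' : j y' == z) :
  y = y' -> val s (exist _ y p) = val s (exist _ y' p').
Proof. by move=> e; congr (fun_of_fin _ _); apply: val_inj. Qed.

Lemma dp_act1 u : dp_act 1 u = u.
Proof.
apply: dp_eq => [|y pu pv] /=; first by rewrite gact1.
rewrite ffunE gact1; case: u pu pv => z s /= pu pv.
by apply: val_section_eq; rewrite /= invg1 gact1.
Qed.

Lemma dp_actM a b u : dp_act (a * b) u = dp_act a (dp_act b u).
Proof.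
apply: dp_eq => [|y pu pv] /=; first by rewrite gactM.
rewrite !ffunE gactM; congr (gact a (gact b _)).
by apply: val_section_eq; rewrite /= invMg gactM.
Qed.

Definition dprod : gset gT := GSet dp_act1 dp_actM.

Definition dp_proj : gmap dprod Z :=
  @GMap _ dprod Z (fun u => tag u) (fun _ _ => erefl).

Definition dp_eval_fun (w : fprod j dp_proj) : X :=
  val (tagged (val w).2) (exist _ (val w).1 (valP w)).

Lemma dp_eval_subproof a w :
  dp_eval_fun (gact a w) = gact a (dp_eval_fun w).
Proof.
rewrite /dp_eval_fun /= ffunE; congr (gact a _).
by apply: val_section_eq; rewrite /= gactK.
Qed.

Definition dp_eval : gmap (fprod j dp_proj) X := GMap dp_eval_subproof.

End DependentProduct.

Definition is_distributor X Y Z A B (i : gmap X Y) (j : gmap Y Z)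
    (f : gmap A X) (g : gmap A B) (h : gmap B Z) : Prop :=
  exists (a : gmap A (fprod j (dp_proj i j))) (b : gmap B (dprod i j)),
    [/\ bijective a, bijective b, f = gcomp (dp_eval i j) a,
        gcomp (fp2 j (dp_proj i j)) a = gcomp b g
      & h = gcomp (dp_proj i j) b].

End FiniteGSets.

Arguments gid {gT} X.
Arguments gempty {gT}.

(* [M] is the common object assignment of the three functors.  Coproducts in
   finite G-sets are generated by the empty set and binary disjoint unions. *)
Record semi_tambara_on (gT : finGroupType) (M : gset gT -> Type) :=
  SemiTambaraOn {
  restr : forall X Y : gset gT, gmap X Y -> M Y -> M X;
  trans : forall X Y : gset gT, gmap X Y -> M X -> M Y;
  norm : forall X Y : gset gT, gmap X Y -> M X -> M Y;
  st_nonempty : forall X, inhabited (M X);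
  restr_id : forall X (u : M X), restr (gid X) u = u;
  restr_comp : forall X Y Z (g : gmap Y Z) (f : gmap X Y) (u : M Z),
    restr (gcomp g f) u = restr f (restr g u);
  trans_id : forall X (u : M X), trans (gid X) u = u;
  trans_comp : forall X Y Z (g : gmap Y Z) (f : gmap X Y) (u : M X),
    trans (gcomp g f) u = trans g (trans f u);
  norm_id : forall X (u : M X), norm (gid X) u = u;
  norm_comp : forall X Y Z (g : gmap Y Z) (f : gmap X Y) (u : M X),
    norm (gcomp g f) u = norm g (norm f u);
  restr_empty : exists! u : M gempty, True;
  restr_sum : forall X Y (u : M X) (v : M Y),
    exists! w : M (gsum X Y),
      restr (ginl X Y) w = u /\ restr (ginr X Y) w = v;
  restr_trans : forall P X Y Z (p : gmap P X) (q : gmap P Y)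
    (i : gmap Y Z) (j : gmap X Z), is_pullback p q i j ->
    forall u : M Y, restr j (trans i u) = trans p (restr q u);
  restr_norm : forall P X Y Z (p : gmap P X) (q : gmap P Y)
    (i : gmap Y Z) (j : gmap X Z), is_pullback p q i j ->
    forall u : M Y, restr j (norm i u) = norm p (restr q u);
  norm_trans : forall X Y Z A B (i : gmap X Y) (j : gmap Y Z)
    (f : gmap A X) (g : gmap A B) (h : gmap B Z),
    is_distributor i j f g h ->
    forall u : M X, norm j (trans i u) = trans h (norm g (restr f u)) }.

Record semi_tambara (gT : finGroupType) := SemiTambara {
  st_ob :> gset gT -> Type;
  st_str : semi_tambara_on st_ob }.

Section SemiTambaraTheory.
Variables (gT : finGroupType) (R : semi_tambara gT).
Definition rs (X Y : gset gT) (f : gmap X Y) : R Y -> R X :=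
  restr (st_str R) f.
Definition tr (X Y : gset gT) (f : gmap X Y) : R X -> R Y :=
  trans (st_str R) f.
Definition nm (X Y : gset gT) (f : gmap X Y) : R X -> R Y :=
  norm (st_str R) f.
End SemiTambaraTheory.

Record st_hom (gT : finGroupType) (R S : semi_tambara gT) := StHom {
  st_fun :> forall X : gset gT, R X -> S X;
  st_fun_rs : forall X Y (f : gmap X Y) u, st_fun (rs f u) = rs f (st_fun u);
  st_fun_tr : forall X Y (f : gmap X Y) u, st_fun (tr f u) = tr f (st_fun u);
  st_fun_nm : forall X Y (f : gmap X Y) u, st_fun (nm f u) = nm f (st_fun u) }.

Section SemiTambaraCategory.
Variable gT : finGroupType.
Implicit Types R S T : semi_tambara gT.

Lemma st_hom_eq R S (phi psi : st_hom R S) :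
  (forall X (u : R X), phi X u = psi X u) -> phi = psi.
Proof.
case: phi psi => phi pr pt pn [psi qr qt qn] /= e.
have {}e : phi = psi.
  by apply: functional_extensionality_dep => X; apply: funext.
case: _ / e qr qt qn => *.
by congr StHom; apply: Prop_irrelevance.
Qed.

Definition st_id R : st_hom R R :=
  @StHom _ R R (fun _ u => u) (fun _ _ _ _ => erefl) (fun _ _ _ _ => erefl)
    (fun _ _ _ _ => erefl).

Section Composition.
Variables (R S T : semi_tambara gT) (phi : st_hom S T) (psi : st_hom R S).

Lemma st_comp_rs X Y (f : gmap X Y) u :
  phi _ (psi _ (rs f u)) = rs f (phi _ (psi _ u)).
Proof. by rewrite !st_fun_rs. Qed.

Lemma st_comp_tr X Y (f : gmap X Y) u :
  phi _ (psi _ (tr f u)) = tr f (phi _ (psi _ u)).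
Proof. by rewrite !st_fun_tr. Qed.

Lemma st_comp_nm X Y (f : gmap X Y) u :
  phi _ (psi _ (nm f u)) = nm f (phi _ (psi _ u)).
Proof. by rewrite !st_fun_nm. Qed.

Definition st_comp : st_hom R T := StHom st_comp_rs st_comp_tr st_comp_nm.

End Composition.

Lemma st_comp1 R S (phi : st_hom R S) : st_comp phi (st_id R) = phi.
Proof. exact: st_hom_eq. Qed.

Lemma st_1comp R S (phi : st_hom R S) : st_comp (st_id S) phi = phi.
Proof. exact: st_hom_eq. Qed.

Lemma st_compA R S T U (f : st_hom T U) (g : st_hom S T) (h : st_hom R S) :
  st_comp f (st_comp g h) = st_comp (st_comp f g) h.
Proof. exact: st_hom_eq. Qed.

Definition sTamb : category := Category st_comp1 st_1comp st_compA.

End SemiTambaraCategory.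

(* The subgroup H as a finite group in its own right. *)
Definition sub_gT (gT : finGroupType) (H : {group gT}) : finGroupType :=
  subg_of H.

Section Induction.
Variables (gT : finGroupType) (H : {group gT}).

Local Notation hT := (sub_gT H).

Definition rset (V : gset gT) : gset hT :=
  @GSet hT V (fun h v => gact (sgval h) v) (@gact1 _ V)
    (fun h k v => gactM (sgval h) (sgval k) v).

Definition rmap (V W : gset gT) (f : gmap V W) : gmap (rset V) (rset W) :=
  @GMap _ (rset V) (rset W) f (fun h v => gmapE f (sgval h) v).

Section InducedSet.
Variable X : gset hT.

Definition ind_rel : rel (gT * X) := fun a b =>
  [exists h : hT, (a.1 == b.1 * sgval h) && (b.2 == gact h a.2)].

Lemma ind_relP a b : reflect
  (exists h : hT, a.1 = b.1 * sgval h /\ b.2 = gact h a.2) (ind_rel a b).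
Proof.
apply: (iffP existsP) => -[h].
  by case/andP => /eqP e /eqP e'; exists h.
by case=> e e'; exists h; rewrite -e -e' !eqxx.
Qed.

Lemma ind_rel_equiv : equiv_class_of ind_rel.
Proof.
have refl : reflexive ind_rel.
  by move=> a; apply/ind_relP; exists 1; rewrite mulg1 gact1.
have symi a b : ind_rel a b -> ind_rel b a.
  case/ind_relP => h [e e']; apply/ind_relP; exists h^-1.
  by rewrite e e' /= mulgK gactK.
split=> // [a b | b a c]; first by apply/idP/idP; apply: symi.
case/ind_relP => h [e e'] /ind_relP[k [f f']]; apply/ind_relP; exists (k * h).
by rewrite e f f' e' gactM /= mulgA.
Qed.

Canonical ind_equiv := EquivRelPack ind_rel_equiv.

(* G x_H X; [icl g x] is the class [g, x]. *)
Definition ind_car : finType := quot_type {eq_quot ind_equiv}.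

Definition icl (g : gT) (x : X) : ind_car := \pi_{eq_quot ind_equiv} (g, x).

Definition irep (w : ind_car) : gT * X :=
  generic_quotient.repr (w : {eq_quot ind_equiv}).

Lemma icl_eq g x g' x' : icl g x = icl g' x' <->
  exists h : hT, g = g' * sgval h /\ x' = gact h x.
Proof.
split=> [/eqmodP/ind_relP //|e]; by apply/eqmodP/ind_relP.
Qed.

Lemma icl_repr (w : ind_car) : icl (irep w).1 (irep w).2 = w.
Proof. by rewrite /icl /irep -surjective_pairing reprK. Qed.

Lemma icl_h g (h : hT) x : icl (g * sgval h) x = icl g (gact h x).
Proof. by apply/icl_eq; exists h. Qed.

Lemma icl_inj g : injective (icl g).
Proof.
move=> x y /icl_eq[h [e ->]].
rewrite (_ : h = 1) ?gact1 //; apply: val_inj => /=.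
by apply: (mulgI g); rewrite -e mulg1.
Qed.

(* Locked, as otherwise unification matches [ind_lift F w] with any class. *)
Definition ind_lift (T : Type) (F : gT -> X -> T) (w : ind_car) : T :=
  locked F (irep w).1 (irep w).2.

Lemma ind_liftE T (F : gT -> X -> T) :
  (forall g (h : hT) x, F (g * sgval h) x = F g (gact h x)) ->
  forall g x, ind_lift F (icl g x) = F g x.
Proof.
move=> FE g x; rewrite /ind_lift -lock.
have := icl_repr (icl g x); case: (irep _) => a y /= /icl_eq[h [-> ->]].
exact: FE.
Qed.

Definition ind_act (a : gT) : ind_car -> ind_car :=
  ind_lift (fun g x => icl (a * g) x).

Lemma ind_actE a g x : ind_act a (icl g x) = icl (a * g) x.
Proof. by rewrite /ind_act ind_liftE // => ? h y; rewrite mulgA icl_h. Qed.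

Lemma ind_act1 w : ind_act 1 w = w.
Proof. by rewrite -(icl_repr w) ind_actE mul1g. Qed.

Lemma ind_actM a b w : ind_act (a * b) w = ind_act a (ind_act b w).
Proof. by rewrite -(icl_repr w) !ind_actE mulgA. Qed.

Definition iset : gset gT := GSet ind_act1 ind_actM.

End InducedSet.

Lemma imap_subproof0 (X Y : gset hT) (f : gmap X Y) g (h : hT) x :
  icl (g * sgval h) (f x) = icl g (f (gact h x)).
Proof. by rewrite icl_h gmapE. Qed.

Definition imap_fun (X Y : gset hT) (f : gmap X Y) : iset X -> iset Y :=
  ind_lift (fun g x => icl g (f x)).

Lemma imap_funE (X Y : gset hT) (f : gmap X Y) g x :
  imap_fun f (icl g x) = icl g (f x).
Proof. exact: (ind_liftE (imap_subproof0 f)). Qed.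

Lemma imap_subproof (X Y : gset hT) (f : gmap X Y) (a : gT) (w : iset X) :
  imap_fun f (gact a w) = gact a (imap_fun f w).
Proof. by rewrite -(icl_repr w) /= ind_actE !imap_funE /= ind_actE. Qed.

Definition imap (X Y : gset hT) (f : gmap X Y) : gmap (iset X) (iset Y) :=
  GMap (imap_subproof f).

Lemma imapE (X Y : gset hT) (f : gmap X Y) g x : imap f (icl g x) = icl g (f x).
Proof. exact: imap_funE. Qed.

Lemma unit_subproof (X : gset hT) (h : hT) (x : X) :
  icl 1 (gact h x) = gact (g := rset (iset X)) h (icl 1 x).
Proof. by rewrite /= ind_actE mulg1 -icl_h mul1g. Qed.

Definition ind_unit (X : gset hT) : gmap X (rset (iset X)) :=
  @GMap _ X (rset (iset X)) (icl 1) (@unit_subproof X).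

Lemma counit_subproof0 (V : gset gT) g (h : hT) (v : rset V) :
  gact (g := V) (g * sgval h) v = gact (g := V) g (gact h v).
Proof. by rewrite gactM. Qed.

Definition counit_fun (V : gset gT) : iset (rset V) -> V :=
  ind_lift (X := rset V) (fun g v => gact (g := V) g v).

Lemma counit_funE (V : gset gT) g (v : rset V) :
  counit_fun (icl g v) = gact (g := V) g v.
Proof. exact: (ind_liftE (@counit_subproof0 V)). Qed.

Lemma counit_subproof (V : gset gT) (a : gT) (w : iset (rset V)) :
  counit_fun (gact a w) = gact a (counit_fun w).
Proof. by rewrite -(icl_repr w) /= ind_actE !counit_funE gactM. Qed.

Definition ind_counit (V : gset gT) : gmap (iset (rset V)) V :=
  @GMap _ (iset (rset V)) V (@counit_fun V) (@counit_subproof V).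

Lemma ind_counitE (V : gset gT) g (v : rset V) :
  ind_counit V (icl g v) = gact (g := V) g v.
Proof. exact: counit_funE. Qed.

End Induction.

Section Criteria.
Variable gT : finGroupType.
Implicit Types X Y Z V A B P T : gset gT.

Lemma gcompP X Y Y' Z (g : gmap Y Z) (f : gmap X Y) (g' : gmap Y' Z)
    (f' : gmap X Y') :
  gcomp g f = gcomp g' f' <-> forall x, g (f x) = g' (f' x).
Proof.
split=> [e x|e]; last exact: gmap_eq.
exact: (congr1 (fun k : gmap X Z => k x) e).
Qed.

Lemma gmap_choice T P (Q : T -> P -> Prop) :
  (forall t, exists w, Q t w) ->
  (forall t w w', Q t w -> Q t w' -> w = w') ->
  (forall a t w, Q t w -> Q (gact a t) (gact a w)) ->
  exists c : gmap T P, forall t, Q t (c t).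
Proof.
move=> Qex Quniq Qact.
pose c t := sval (cid (Qex t)); have cP t : Q t (c t) := svalP (cid (Qex t)).
have cE a t : c (gact a t) = gact a (c t).
  by apply: (Quniq (gact a t)); [apply: cP | apply/Qact/cP].
by exists (GMap cE).
Qed.

Lemma is_pullbackP P X Y Z (p : gmap P X) (q : gmap P Y) (i : gmap Y Z)
    (j : gmap X Z) :
  is_pullback p q i j <->
  [/\ forall w, j (p w) = i (q w),
      forall x y, j x = i y -> exists w, p w = x /\ q w = y
    & forall w w', p w = p w' -> q w = q w' -> w = w'].
Proof.
split=> [[/gcompP sq univ]|[sq ex inj]]; last first.
  split=> [|T a b /gcompP e]; first exact/gcompP.
  have [|||c cP] := @gmap_choice T P (fun t w => p w = a t /\ q w = b t).
  - by move=> t; apply: ex.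
  - by move=> t w w' [pw qw] [pw' qw']; apply: inj; rewrite ?pw ?qw.
  - by move=> g t w [pw qw]; rewrite !gmapE pw qw.
  exists c; split=> [|c' [ca cb]].
    by split; apply: gmap_eq => t /=; case: (cP t).
  apply: gmap_eq => t; case: (cP t) => pc qc.
  by apply: inj; rewrite ?pc ?qc -?ca -?cb.
have [|c [[c1 c2] _]] := univ (fprod j i) (fp1 j i) (fp2 j i).
  by apply/gcompP => w; apply/eqP/(valP w).
have {}c1 w : p (c w) = (val w).1.
  exact: (congr1 (fun k : gmap _ _ => k w) c1).
have {}c2 w : q (c w) = (val w).2.
  exact: (congr1 (fun k : gmap _ _ => k w) c2).
have dP w : j (p w) == i (q w) by rewrite sq.
pose d0 w : fprod j i := exist _ (p w, q w) (dP w).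
have d0E a w : d0 (gact a w) = gact a (d0 w).
  by apply: val_inj; rewrite /= !gmapE.
pose d := GMap d0E.
have cd : gcomp c d = gid P.
  have [|k [_ kuniq]] := univ P p q; first exact/gcompP.
  rewrite -(kuniq (gcomp c d)) ?(kuniq (gid P)) //.
    by split; apply: gmap_eq.
  by split; apply: gmap_eq => w /=; rewrite ?c1 ?c2.
split=> // [x y e|w w' e e'].
  have e' : j x == i y by apply/eqP.
  by exists (c (exist _ (x, y) e')); rewrite c1 c2.
have cdE v : c (d v) = v by exact: (congr1 (fun k : gmap _ _ => k v) cd).
rewrite -(cdE w) -(cdE w'); congr (c _).
by apply: val_inj; rewrite /= e e'.
Qed.

Section Distributor.
Variables (X Y Z A B : gset gT) (i : gmap X Y) (j : gmap Y Z).
Variables (f : gmap A X) (g : gmap A B) (h : gmap B Z).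

Record distr_spec : Prop := DistrSpec {
  ds_sq : forall a, h (g a) = j (i (f a));
  ds_ex : forall y b, j y = h b -> exists a, i (f a) = y /\ g a = b;
  ds_inj : forall a a', i (f a) = i (f a') -> g a = g a' -> a = a';
  ds_uniq : forall b b', h b = h b' ->
    (forall a a', g a = b -> g a' = b' -> i (f a) = i (f a') -> f a = f a') ->
    b = b';
  ds_sec : forall z (s : forall y, j y = z -> X),
    (forall y e, i (s y e) = y) ->
    exists b, h b = z /\ forall a y e, g a = b -> i (f a) = y -> f a = s y e }.

Lemma is_distributorP : is_distributor i j f g h <-> distr_spec.
Proof.
split=> [[ka [kb [bija bijb fE gE hE]]]|[sq ex inj uniq sec]].
  have kaE a : (val (ka a)).2 = kb (g a).
    exact: (congr1 (fun k : gmap _ _ => k a) gE).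
  have jka a : j (val (ka a)).1 = tag (kb (g a)).
    by rewrite -kaE; apply/eqP/(valP (ka a)).
  have fv a : f a = dp_eval i j (ka a) by rewrite fE.
  have ifa a : i (f a) = (val (ka a)).1 by rewrite fv [LHS]sectionE.
  have hv b : h b = tag (kb b) by rewrite hE.
  have kainj := bij_inj bija; have kbinj := bij_inj bijb.
  have [ka' kaK ka'K] := bija; have [kb' kbK kb'K] := bijb.
  have exA y b : j y = h b ->
      exists a, [/\ i (f a) = y, g a = b
        & forall e, f a = val (tagged (kb b)) (exist _ y e)].
    rewrite hv => /eqP e.
    pose w : fprod j (dp_proj i j) := exist _ (y, kb b) e.
    exists (ka' w); split; first by rewrite ifa ka'K.
      by apply: kbinj; rewrite -kaE ka'K.
    by move=> e'; rewrite fv ka'K; apply: val_section_eq.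
  split.
  - by move=> a; rewrite hv ifa jka.
  - by move=> y b /exA[a []]; exists a.
  - move=> a a' e e'; apply: kainj; apply: val_inj.
    by apply: injective_projections; rewrite -?ifa ?kaE // e'.
  - move=> b b' e eqf; apply: kbinj; apply: dp_eq => [|y pu pv].
      by rewrite -!hv.
    have [|a [ifay ga <-]] := exA y b; first by rewrite hv (eqP pu).
    have [|a' [ifay' ga' <-]] := exA y b'; first by rewrite hv (eqP pv).
    by apply: eqf => //; rewrite ifay.
  - move=> z s sP.
    pose s0 : {ffun fiber j z -> X} :=
      [ffun y => s (val y) (fiberE y)].
    have s0P : [forall y, i (s0 y) == val y].
      by apply/forallP => y; rewrite ffunE sP.
    pose b : dprod i j := existT (sections i j) z (Sub s0 s0P).
    exists (kb' b); split=> [|a y e ga ifay]; first by rewrite hv kb'K.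
    have e' : kb (g a) = b by rewrite ga kb'K.
    have [|a' [ifa' ga' fa']] := exA y (g a).
      by rewrite hv e' /= e.
    have -> : a = a'.
      apply: kainj; apply: val_inj; apply: injective_projections.
        by rewrite -!ifa ifay ifa'.
      by rewrite !kaE ga'.
    have py : j y == tag (kb (g a)) by rewrite e' /= e.
    rewrite (fa' py); move: py; rewrite e' /= => py.
    by rewrite ffunE /=; congr s; apply: Prop_irrelevance.
have [|||b0 b0P] := @gmap_choice B (dprod i j) (fun b u => tag u = h b /\
    forall a y e, g a = b -> i (f a) = y ->
      f a = val (tagged u) (exist _ y e)).
  - move=> b.
    have exs (y : fiber j (h b)) : exists x, exists a,
        [/\ i (f a) = val y, g a = b & f a = x].
      have [|a [e e']] := ex (val y) b; first exact/eqP/(valP y).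
      by exists (f a), a.
    pose s0 : {ffun fiber j (h b) -> X} := [ffun y => sval (cid (exs y))].
    have s0E y : exists a, [/\ i (f a) = val y, g a = b & f a = s0 y].
      by rewrite ffunE; case: cid.
    have s0P : [forall y, i (s0 y) == val y].
      by apply/forallP => y; case: (s0E y) => a [<- _ <-].
    exists (existT (sections i j) (h b) (Sub s0 s0P)); split=> //= a y e ga fa.
    case: (s0E (exist _ y e)) => a' /= [fa' ga' <-]; congr (f _).
    by apply: inj; rewrite ?fa ?ga.
  - move=> b u v [tu uP] [tv vP]; apply: dp_eq => [|y pu pv].
      by rewrite tu tv.
    have [|a [fa ga]] := ex y b; first by rewrite -tu (eqP pu).
    by rewrite -(uP a) // -(vP a).
  - move=> k b u [tu uP]; split=> [|a y e ga fa]; first by rewrite /= tu gmapE.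
    have {1}<- := gactKV k (f a).
    rewrite -gmapE /= ffunE; congr (gact k _); apply: uP.
      by rewrite gmapE ga gactK.
    by rewrite !gmapE fa.
have [a|a w w' <- /val_inj //|k a w e|a0 a0P] :=
    @gmap_choice A (fprod j (dp_proj i j))
      (fun a w => val w = (i (f a), b0 (g a))).
    have e : j (i (f a)) == dp_proj i j (b0 (g a)).
      by rewrite /= (b0P _).1 sq.
    by exists (exist _ (i (f a), b0 (g a)) e).
  by rewrite /= e !gmapE.
have b0bij : exists k, forall u, b0 (k u) = u.
  suff exb u : exists b, b0 b = u.
    by exists (fun u => sval (cid (exb u))) => u; case: cid.
  case: u => z s.
  have [|b [hb bP]] := sec z (fun y e => val s (exist _ y (introT eqP e))).
    by move=> y e; rewrite sectionE.
  exists b; apply: dp_eq => [|y pu pv]; first by rewrite (b0P b).1.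
  have [|a [fa ga]] := ex y b; first by rewrite hb (eqP pv).
  rewrite -((b0P b).2 a y pu ga fa) (bP a y (eqP pv) ga fa) /=.
  exact: val_section_eq.
have b0inj : injective b0.
  move=> b b' e; apply: uniq => [|a a' ga ga' faa'].
    by rewrite -(b0P b).1 -(b0P b').1 e.
  have py : j (i (f a)) == tag (b0 b) by rewrite (b0P b).1 -ga sq.
  rewrite ((b0P b).2 a _ py ga erefl).
  by move: py; rewrite e => py; apply/esym/(b0P b').2.
have [b1 b0K] := b0bij.
have bijb : bijective b0.
  by exists b1 => // b; apply: b0inj; rewrite b0K.
have bija : bijective a0.
  have exa w : exists a, a0 a = w.
    have [|a [fa ga]] := ex (val w).1 (b1 (val w).2).
      rewrite -(b0P _).1 b0K; exact/eqP/(valP w).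
    exists a; apply: val_inj; rewrite a0P fa ga b0K.
    by rewrite -surjective_pairing.
  exists (fun w => sval (cid (exa w))); last by move=> w; case: cid.
  move=> a; case: cid => a' /= /(congr1 val); rewrite !a0P => -[fa ga].
  by apply: inj => //; apply: b0inj.
exists a0, b0; split=> //; apply: gmap_eq => x /=.
- by rewrite /dp_eval_fun; move: (valP (a0 x)); rewrite a0P /= => e;
     apply: (b0P _).2.
- by rewrite a0P.
- by rewrite (b0P _).1.
Qed.

End Distributor.
End Criteria.

Section SemiTambaraLemmas.
Variables (gT : finGroupType) (R : semi_tambara gT).
Implicit Types X Y Z : gset gT.

Lemma rs_id X (u : R X) : rs (gid X) u = u. Proof. exact: restr_id. Qed.
Lemma tr_id X (u : R X) : tr (gid X) u = u. Proof. exact: trans_id. Qed.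
Lemma nm_id X (u : R X) : nm (gid X) u = u. Proof. exact: norm_id. Qed.
Lemma rs_comp X Y Z (g : gmap Y Z) (f : gmap X Y) (u : R Z) :
  rs (gcomp g f) u = rs f (rs g u).
Proof. exact: restr_comp. Qed.
Lemma tr_comp X Y Z (g : gmap Y Z) (f : gmap X Y) (u : R X) :
  tr (gcomp g f) u = tr g (tr f u).
Proof. exact: trans_comp. Qed.
Lemma nm_comp X Y Z (g : gmap Y Z) (f : gmap X Y) (u : R X) :
  nm (gcomp g f) u = nm g (nm f u).
Proof. exact: norm_comp. Qed.

Lemma gmap_inv X Y (f : gmap X Y) : bijective f ->
  exists f' : gmap Y X, gcomp f' f = gid X /\ gcomp f f' = gid Y.
Proof.
case=> k fK kK; have kE a y : k (gact a y) = gact a (k y).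
  by rewrite -{1}(kK y) -gmapE fK.
by exists (GMap kE); split; apply: gmap_eq => x /=.
Qed.

Lemma is_coprod_restr X Y Z (a : gmap X Z) (b : gmap Y Z) :
  injective a -> injective b -> (forall x y, a x <> b y) ->
  (forall z, (exists x, a x = z) \/ (exists y, b y = z)) ->
  forall (u : R X) (v : R Y), exists! w : R Z, rs a w = u /\ rs b w = v.
Proof.
move=> ainj binj nab surj u v.
pose k0 (w : gsum X Y) : Z := match w with inl x => a x | inr y => b y end.
have k0E c w : k0 (gact c w) = gact c (k0 w) by case: w => w; apply: gmapE.
pose k := @GMap _ (gsum X Y) Z k0 k0E.
have kbij : bijective k.
  have kex z : exists w, k w = z.
    by case: (surj z) => -[x <-]; [exists (inl x) | exists (inr x)].
  exists (fun z => sval (cid (kex z))); last by move=> z; case: cid.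
  move=> w; case: cid => -[x|x]; case: w => y //= /esym.
  - by move/ainj->.
  - by move/esym/nab.
  - by move/nab.
  - by move/binj->.
have [k' [k'k kk']] := gmap_inv kbij.
have ka : a = gcomp k (ginl X Y) by apply: gmap_eq.
have kb : b = gcomp k (ginr X Y) by apply: gmap_eq.
have [w [[wu wv] wuniq]] := restr_sum (st_str R) u v.
exists (rs k' w); split=> [|w' [wu' wv']].
  by rewrite ka kb !rs_comp -!(rs_comp k') k'k !rs_id.
rewrite (wuniq (rs k w')); first by rewrite -rs_comp kk' rs_id.
by rewrite /rs -!restr_comp -ka -kb.
Qed.

End SemiTambaraLemmas.

Section RestrictionFunctor.
Variables (gT : finGroupType) (H : {group gT}).
Local Notation hT := (sub_gT H).
Implicit Types X Y Z : gset hT.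

Lemma inl_inj (T U : Type) : injective (@inl T U). Proof. by move=> x y []. Qed.
Lemma inr_inj (T U : Type) : injective (@inr T U). Proof. by move=> x y []. Qed.

Lemma icl_ex X (w : iset X) : exists g x, w = icl g x.
Proof. by exists (irep w).1, (irep w).2; rewrite icl_repr. Qed.

Lemma imap_lift X Y (f : gmap X Y) (w : iset X) g y :
  imap f w = icl g y -> exists x, w = icl g x /\ f x = y.
Proof.
have [a [x ->]] := icl_ex w; rewrite imapE => /icl_eq[h [-> ->]].
by exists (gact h x); rewrite gmapE icl_h.
Qed.

Lemma imap_id X : imap (gid X) = gid (iset X).
Proof. by apply: gmap_eq => w; have [a [x ->]] := icl_ex w; rewrite /= imap_funE. Qed.

Lemma imap_comp X Y Z (g : gmap Y Z) (f : gmap X Y) :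
  imap (gcomp g f) = gcomp (imap g) (imap f).
Proof.
by apply: gmap_eq => w; have [a [x ->]] := icl_ex w; rewrite /= !imap_funE.
Qed.

Lemma imap_pullback P X Y Z (p : gmap P X) (q : gmap P Y)
    (i : gmap Y Z) (j : gmap X Z) :
  is_pullback p q i j -> is_pullback (imap p) (imap q) (imap i) (imap j).
Proof.
case/is_pullbackP => sq ex inj; apply/is_pullbackP; split.
- by move=> w; have [a [x ->]] := icl_ex w; rewrite !imapE sq.
- move=> w w'; have [a [x ->]] := icl_ex w; rewrite imapE => /esym.
  case/imap_lift => y [-> e]; have [|v [<- <-]] := ex x y; first by rewrite e.
  by exists (icl a v); rewrite !imapE.
- move=> w w'; have [a [x ->]] := icl_ex w; rewrite !imapE => /esym.
  case/imap_lift => y [-> pe]; rewrite imapE => /icl_inj qe.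
  by rewrite (inj x y).
Qed.

Lemma imap_distributor X Y Z A B (i : gmap X Y) (j : gmap Y Z)
    (f : gmap A X) (g : gmap A B) (h : gmap B Z) :
  is_distributor i j f g h ->
  is_distributor (imap i) (imap j) (imap f) (imap g) (imap h).
Proof.
case/is_distributorP => sq ex inj uniq sec; apply/is_distributorP; split.
- by move=> w; have [a [x ->]] := icl_ex w; rewrite !imapE sq.
- move=> w w'; have [a [y ->]] := icl_ex w; rewrite imapE => /esym.
  case/imap_lift => b [-> e]; have [|v [<- <-]] := ex y b; first by rewrite e.
  by exists (icl a v); rewrite !imapE.
- move=> w w'; have [a [x ->]] := icl_ex w; rewrite !imapE => ei.
  move=> /esym/imap_lift[y [e' ge]]; move: ei; rewrite e' !imapE.
  by move=> /icl_inj e; rewrite (inj x y).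
- move=> w w'; have [a [b ->]] := icl_ex w; rewrite imapE => /esym.
  case/imap_lift => b' [-> e] eqf; rewrite (uniq b b') // => c c' gc gc' ifc.
  apply: (@icl_inj _ _ _ a); rewrite -!imapE.
  by rewrite (eqf (icl a c) (icl a c')) // !imapE ?gc ?gc' ?ifc.
- move=> w s sP; have [a [z ez]] := icl_ex w.
  have je y : j y = z -> imap j (icl a y) = w by move=> e; rewrite imapE e.
  have s0 y (e : j y = z) : {x | s (icl a y) (je y e) = icl a x /\ i x = y}.
    by apply: cid; apply: imap_lift; rewrite sP.
  have [|b [hb bP]] := sec z (fun y e => sval (s0 y e)).
    by move=> y e; case: (s0 y e) => x [].
  exists (icl a b); split=> [|c v e gc ifc]; first by rewrite imapE hb.
  have [c0 [ec gc0]] := imap_lift gc; rewrite ec in ifc *.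
  move: e; rewrite -ifc !imapE => e.
  have jz : j (i (f c0)) = z by apply: (@icl_inj _ _ _ a); rewrite -ez -e imapE.
  have := bP c0 _ jz gc0 erefl; case: (s0 _ jz) => x [/= e2 _] e1.
  rewrite [in LHS]e1 -e2; congr (s _ _); exact: Prop_irrelevance.
Qed.

Section ResObject.
Variable R : semi_tambara gT.

Definition res_ob X : Type := R (iset X).

Lemma res_sum X Y (u : res_ob X) (v : res_ob Y) :
  exists! w : res_ob (gsum X Y),
    rs (imap (ginl X Y)) w = u /\ rs (imap (ginr X Y)) w = v.
Proof.
apply: is_coprod_restr.
- move=> w w'; have [a [x ->]] := icl_ex w; rewrite !imapE => /esym.
  by case/imap_lift => y [-> e]; rewrite (@inl_inj X Y _ _ e).
- move=> w w'; have [a [x ->]] := icl_ex w; rewrite !imapE => /esym.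
  by case/imap_lift => y [-> e]; rewrite (@inr_inj X Y _ _ e).
- move=> w w'; have [a [x ->]] := icl_ex w; rewrite !imapE => /esym.
  by case/imap_lift => y [_].
move=> w; have [a [z ->]] := icl_ex w; case: z => [x|y].
  by left; exists (icl a x); rewrite imapE.
by right; exists (icl a y); rewrite imapE.
Qed.

Lemma res_empty : exists! u : res_ob gempty, True.
Proof.
have e0 (w : iset (@gempty hT)) : False by have [_ [x _]] := icl_ex w; case: x.
have e0E a (w : iset (@gempty hT)) :
  (False_rect gempty (e0 (gact a w))) = gact a (False_rect gempty (e0 w)).
  by case: (e0 w).
have e1E a (w : @gempty gT) : (False_rect (iset (@gempty hT)) (match w with end))
   = gact a (False_rect (iset (@gempty hT)) (match w with end)) by case: w.
pose k := @GMap _ (iset gempty) gempty _ e0E.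
pose k' : gmap gempty (iset (@gempty hT)) := @GMap _ gempty _ _ e1E.
have kk' : gcomp k' k = gid _ by apply: gmap_eq => w; case: (e0 w).
have [u [_ uP]] := restr_empty (st_str R).
exists (rs k u); split=> // v _.
by rewrite (uP (rs k' v)) // -rs_comp kk' rs_id.
Qed.

Definition res_str : semi_tambara_on res_ob.
Proof.
refine (@SemiTambaraOn hT res_ob
  (fun X Y f u => rs (imap f) u) (fun X Y f u => tr (imap f) u)
  (fun X Y f u => nm (imap f) u) _ _ _ _ _ _ _ res_empty res_sum _ _ _).
- by move=> X; apply: st_nonempty (st_str R) _.
- by move=> X u; rewrite imap_id rs_id.
- by move=> X Y Z g f u; rewrite imap_comp rs_comp.
- by move=> X u; rewrite imap_id tr_id.
- by move=> X Y Z g f u; rewrite imap_comp tr_comp.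
- by move=> X u; rewrite imap_id nm_id.
- by move=> X Y Z g f u; rewrite imap_comp nm_comp.
- by move=> P X Y Z p q i j /imap_pullback/(restr_trans (st_str R)).
- by move=> P X Y Z p q i j /imap_pullback/(restr_norm (st_str R)).
- by move=> X Y Z A B i j f g h /imap_distributor/(norm_trans (st_str R)).
Defined.

Definition res_st : semi_tambara hT := SemiTambara res_str.

End ResObject.
End RestrictionFunctor.

Section ResFunctor.
Variables (gT : finGroupType) (H : {group gT}).

Definition res_hom (R S : semi_tambara gT) (phi : st_hom R S) :
    st_hom (res_st H R) (res_st H S) :=
  @StHom _ (res_st H R) (res_st H S) (fun X u => phi (iset X) u)
    (fun X Y f => st_fun_rs phi (imap f)) (fun X Y f => st_fun_tr phi (imap f))
    (fun X Y f => st_fun_nm phi (imap f)).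

Lemma res_hom_id (R : semi_tambara gT) :
  res_hom (st_id R) = st_id (res_st H R).
Proof. exact: st_hom_eq. Qed.

Lemma res_hom_comp (R S T : semi_tambara gT) (f : st_hom S T)
  (g : st_hom R S) : res_hom (st_comp f g) = st_comp (res_hom f) (res_hom g).
Proof. exact: st_hom_eq. Qed.

Definition Res : functor (sTamb gT) (sTamb (sub_gT H)) :=
  @Functor (sTamb gT) (sTamb (sub_gT H)) (res_st H) res_hom
    res_hom_id res_hom_comp.

End ResFunctor.

Section NormObject.
Variables (gT : finGroupType) (H : {group gT}).
Local Notation hT := (sub_gT H).
Variable R : semi_tambara hT.

Record sN_pre (X : gset gT) := SNPre {
  sN_V : gset gT;
  sN_j : gmap sN_V X;
  sN_u : R (rset H sN_V) }.

(* [sN_iso] is the isomorphism relation on pairs (V -> X, u).  In [sN_gen], the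
   identification [g, v] |-> (gH, gv) of G x_H Res V with G/H x V turns the
   projection to V into [ind_counit H V], and (D, e, p) ranges over all choices
   of D_H(W, f, V), which is determined only up to isomorphism. *)
Inductive sN_step (X : gset gT) : sN_pre X -> sN_pre X -> Prop :=
| sN_iso (V V' : gset gT) (j : gmap V X) (j' : gmap V' X)
    (u : R (rset H V)) (u' : R (rset H V')) (f : gmap V' V) :
    bijective f -> gcomp j f = j' -> rs (rmap H f) u = u' ->
    sN_step (SNPre j u) (SNPre j' u')
| sN_gen (V : gset gT) (j : gmap V X) (W : gset hT) (f : gmap W (rset H V))
    (w : R W) (D : gset gT) (e : gmap (rset H D) W) (p : gmap D V) :
    is_distributor (imap f) (ind_counit H V) (imap e) (ind_counit H D) p ->
    sN_step (SNPre j (tr f w)) (SNPre (gcomp j p) (rs e w)).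

(* Both quotients at once: isomorphism classes of pairs, modulo the smallest
   equivalence relation generated by [sN_gen]. *)
Definition sN_eq (X : gset gT) : sN_pre X -> sN_pre X -> Prop :=
  clos_refl_sym_trans _ (@sN_step X).

Definition sN_ob (X : gset gT) : Type :=
  {c : sN_pre X -> Prop | exists a, c = sN_eq a}.

Definition sN_cl (X : gset gT) (a : sN_pre X) : sN_ob X :=
  exist _ (sN_eq a) (ex_intro _ a erefl).

Lemma sN_cl_ex X (c : sN_ob X) : exists a, c = sN_cl a.
Proof.
case: c => c [a e]; exists a; rewrite /sN_cl; subst c.
by congr exist; apply: Prop_irrelevance.
Qed.

Lemma sN_clP X (a b : sN_pre X) : sN_cl a = sN_cl b <-> sN_eq a b.
Proof.
split=> [[e]|ab]; first by rewrite e; apply: rst_refl.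
have e : sN_eq a = sN_eq b.
  apply: funext => c; apply: propext; split; last exact: rst_trans ab.
  exact/rst_trans/rst_sym.
rewrite /sN_cl; move: (ex_intro _ _ _) (ex_intro _ _ _); rewrite e => p q.
by congr exist; apply: Prop_irrelevance.
Qed.

Lemma sN_cl_step X (a b : sN_pre X) : sN_step a b -> sN_cl a = sN_cl b.
Proof. by move=> ab; apply/sN_clP/rst_step. Qed.

Definition sN_lift (X : gset gT) (T : Type) (F : sN_pre X -> T)
  (c : sN_ob X) : T := F (sval (cid (sN_cl_ex c))).

Lemma sN_liftE X (T : Type) (F : sN_pre X -> T) :
  (forall a b, sN_step a b -> F a = F b) ->
  forall a, sN_lift F (sN_cl a) = F a.
Proof.
move=> FE a; rewrite /sN_lift; case: cid => b /= /sN_clP.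
by elim=> [x y /FE|//|x y _ ->//|x y z _ -> _ ->].
Qed.

Lemma rmap_id V : rmap H (gid V) = gid (rset H V).
Proof. exact: gmap_eq. Qed.

Lemma rmap_comp X Y Z (g : gmap Y Z) (f : gmap X Y) :
  rmap H (gcomp g f) = gcomp (rmap H g) (rmap H f).
Proof. exact: gmap_eq. Qed.

Lemma rmap_pullback P X Y Z (p : gmap P X) (q : gmap P Y)
    (i : gmap Y Z) (j : gmap X Z) : is_pullback p q i j ->
  is_pullback (rmap H p) (rmap H q) (rmap H i) (rmap H j).
Proof. by case/is_pullbackP => sq ex inj; apply/is_pullbackP; split. Qed.

Lemma fprod_pullback (kT : finGroupType) (X Y Z : gset kT) (i : gmap X Z)
  (j : gmap Y Z) : is_pullback (fp1 i j) (fp2 i j) j i.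
Proof.
apply/is_pullbackP; split; first by move=> w; apply/eqP/(valP w).
  by move=> x y /eqP e; exists (exist _ (x, y) e).
by move=> w w' e e'; apply: val_inj; apply: injective_projections.
Qed.

Lemma dprod_distributor (kT : finGroupType) (X Y Z : gset kT) (i : gmap X Y)
  (j : gmap Y Z) : is_distributor i j (dp_eval i j) (fp2 j (dp_proj i j))
                     (dp_proj i j).
Proof.
exists (gid _), (gid _).
by split; try (by exists id); apply: gmap_eq.
Qed.

Section DH.
Variables (V : gset gT) (W : gset hT) (f : gmap W (rset H V)).
Variables (D : gset gT) (e : gmap (rset H D) W) (p : gmap D V).

(* D_H(W, f, V) consists of the v in V with an H-map s from G to W such that
   f (s g) = g v. *)
Record dh_spec : Prop := DHSpec {
  dh_sq : forall d : D, f (e d) = p d;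
  dh_inj : forall d d' : D, p d = p d' ->
    (forall g, e (gact (g := D) g d) = e (gact (g := D) g d')) -> d = d';
  dh_sec : forall (v : V) (s : gT -> W),
    (forall g (h : hT), s (sgval h * g) = gact h (s g)) ->
    (forall g, f (s g) = gact (g := V) g v) ->
    exists d : D, p d = v /\ forall g, e (gact (g := D) g d) = s g }.

Lemma icl_hV (X : gset hT) g (h : hT) (x : X) :
  icl (g * sgval h^-1) (gact h x) = icl g x.
Proof. by rewrite icl_h gactK. Qed.

Lemma dh_specP :
  is_distributor (imap f) (ind_counit H V) (imap e) (ind_counit H D) p <->
  dh_spec.
Proof.
split=> [/is_distributorP[sq ex inj uniq sec]|[sq inj sec]].
  have sq' (d : D) : f (e d) = p d.
    have := sq (icl 1 (d : rset H D)).
    by rewrite !imapE !ind_counitE !gact1.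
  split=> // [d d' pd ed|v s sE sf].
    apply: uniq => // a a'; have [g [x ->]] := icl_ex a.
    rewrite ind_counitE !imapE => gx a'E /esym/imap_lift[w [wE fw]].
    have [x' [a'x ex']] := imap_lift wE; rewrite a'x in a'E *.
    move: a'E; rewrite imapE ind_counitE => gx'.
    have -> : x = gact (g := D) g^-1 d by rewrite -gx gactK.
    have -> : x' = gact (g := D) g^-1 d' by rewrite -gx' gactK.
    by rewrite ed.
  pose F g (_ : rset H V) : iset W := icl g (s g^-1).
  have FE g (h : hT) x : F (g * sgval h) x = F g (gact h x).
    by rewrite /F invMg (sE _ h^-1) icl_h gactKV.
  have [|b [pb bP]] := sec v (fun y _ => ind_lift F y).
    move=> y; have [g [x ->]] := icl_ex y.
    rewrite ind_counitE (ind_liftE FE) imapE sf => <-.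
    by rewrite gactK.
  exists b; split=> // g.
  have := bP (icl g^-1 (gact (g := D) g b : rset H D))
             (icl g^-1 (gact (g := V) g v : rset H V)).
  rewrite !ind_counitE !gactK !imapE => /(_ erefl erefl).
  rewrite (ind_liftE FE) /F invgK sq' gmapE pb => /(_ erefl).
  exact: icl_inj.
apply/is_distributorP; split.
- move=> w; have [g [d ->]] := icl_ex w.
  by rewrite !imapE !ind_counitE gmapE sq.
- move=> y b; have [g [v ->]] := icl_ex y; rewrite ind_counitE => gv.
  exists (icl g (gact (g := D) g^-1 b : rset H D)).
  by rewrite !imapE ind_counitE gactKV sq gmapE -gv gactK.
- move=> a a'; have [g [d ->]] := icl_ex a; rewrite !imapE => /esym.
  move=> /imap_lift[w [/imap_lift[d' [-> _]] _]].
  rewrite !ind_counitE => gd; congr icl.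
  by rewrite -(gactK g (d : D)) gd gactK.
- move=> b b' pb ef; apply: inj => // g.
  have := ef (icl g^-1 (gact (g := D) g b : rset H D))
             (icl g^-1 (gact (g := D) g b' : rset H D)).
  rewrite !imapE !ind_counitE !gactK !sq !gmapE pb => /(_ erefl erefl erefl).
  exact: icl_inj.
move=> v s sP.
pose y g := icl g^-1 (gact (g := V) g v : rset H V).
have yv g : ind_counit H V (y g) = v by rewrite ind_counitE gactK.
have s0 g : {x | s (y g) (yv g) = icl g^-1 x /\ f x = gact (g := V) g v}.
  by apply: cid; apply: imap_lift; rewrite sP.
have sE y1 y2 e1 e2 : y1 = y2 -> s y1 e1 = s y2 e2.
  by move=> e12; subst y2; congr s; apply: Prop_irrelevance.
have [||b [pb bP]] := sec v (fun g => sval (s0 g)).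
- move=> g h; case: (s0 _) => x /= [xE _]; case: (s0 g) => x' /= [x'E _].
  apply: (@icl_inj _ _ _ (sgval h * g)^-1); rewrite -xE invMg icl_hV -x'E.
  apply: sE; rewrite /y invMg gactM -(icl_hV g^-1 h).
  by [].
- by move=> g; case: (s0 g) => x [].
exists b; split=> // a z ez; have [g [d ->]] := icl_ex a.
rewrite ind_counitE => gd; rewrite !imapE sq => zE.
have dE : d = gact (g := D) g^-1 b by rewrite -gd gactK.
rewrite dE bP; case: (s0 _) => x /= [+ _]; rewrite invgK => <-.
by apply: sE; rewrite /y invgK -zE dE gmapE pb.
Qed.

End DH.

Lemma SNPre_iso X V V' (j : gmap V X) (j' : gmap V' X) (u : R (rset H V))
    (u' : R (rset H V')) (f : gmap V' V) : bijective f ->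
  (forall x, j (f x) = j' x) -> rs (rmap H f) u = u' ->
  sN_cl (SNPre j u) = sN_cl (SNPre j' u').
Proof.
by move=> fbij fj fu; apply/sN_cl_step/(sN_iso fbij) => //; apply: gmap_eq.
Qed.

Definition pre_tr X Y (f : gmap X Y) (a : sN_pre X) : sN_ob Y :=
  sN_cl (SNPre (gcomp f (sN_j a)) (sN_u a)).

Definition pre_rs X Y (f : gmap X Y) (a : sN_pre Y) : sN_ob X :=
  sN_cl (SNPre (fp1 f (sN_j a)) (rs (rmap H (fp2 f (sN_j a))) (sN_u a))).

Definition pre_nm X Y (f : gmap X Y) (a : sN_pre X) : sN_ob Y :=
  sN_cl (SNPre (dp_proj (sN_j a) f)
    (nm (rmap H (fp2 f (dp_proj (sN_j a) f)))
        (rs (rmap H (dp_eval (sN_j a) f)) (sN_u a)))).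

Lemma pre_rsE X Y (f : gmap X Y) V (j : gmap V Y) (u : R (rset H V))
    P (p : gmap P X) (q : gmap P V) : is_pullback p q j f ->
  pre_rs f (SNPre j u) = sN_cl (SNPre p (rs (rmap H q) u)).
Proof.
case/is_pullbackP => sq ex inj; rewrite /pre_rs /=.
have dP w : f (p w) == j (q w) by rewrite sq.
pose d0 w : fprod f j := exist _ (p w, q w) (dP w).
have d0E a w : d0 (gact a w) = gact a (d0 w).
  by apply: val_inj; rewrite /= !gmapE.
apply: (SNPre_iso (f := GMap d0E)) => //.
  have kex w : exists v, d0 v = w.
    have [|v [pv qv]] := ex (val w).1 (val w).2; first exact/eqP/(valP w).
    by exists v; apply: val_inj; rewrite /= pv qv -surjective_pairing.
  exists (fun w => sval (cid (kex w))) => [w|w]; case: cid => //= v.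
  by case=> pv qv; apply: inj.
by rewrite -rs_comp -rmap_comp; congr (rs (rmap H _) u); apply: gmap_eq.
Qed.

Lemma pre_nmE X Y (f : gmap X Y) V (j : gmap V X) (u : R (rset H V))
    E D (e : gmap E V) (k : gmap E D) (p : gmap D Y) :
  is_distributor j f e k p ->
  pre_nm f (SNPre j u) = sN_cl (SNPre p (nm (rmap H k) (rs (rmap H e) u))).
Proof.
case=> a [b [bija bijb eE kE pE]]; rewrite /pre_nm /=.
apply: (SNPre_iso (f := b)) => //; first by move=> x; rewrite pE.
have pb : is_pullback k a (fp2 f (dp_proj j f)) b.
  have kP := (proj1 (gcompP _ _ _ _) kE).
  have [a' aK a'K] := bija; have [b' bK b'K] := bijb.
  apply/is_pullbackP; split=> [w|x y xy|w w' _ /(bij_inj bija) //].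
    by rewrite [RHS]kP.
  exists (a' y); rewrite a'K; split=> //; apply: (bij_inj bijb).
  by rewrite -[LHS]kP /= a'K xy.
rewrite /rs /nm (restr_norm (st_str R) (rmap_pullback pb)).
by rewrite eE rmap_comp restr_comp.
Qed.

Lemma pre_tr_step X Y (f : gmap X Y) a b :
  sN_step a b -> pre_tr f a = pre_tr f b.
Proof.
case=> {a b} [V V' j j' u u' g gbij <- gu|V j W g w D e p dg].
  exact: (SNPre_iso (f := g)).
rewrite /pre_tr /=; have -> : gcomp f (gcomp j p) = gcomp (gcomp f j) p.
  exact: gmap_eq.
exact/sN_cl_step/sN_gen.
Qed.

Lemma pre_rs_step X Y (f : gmap X Y) a b :
  sN_step a b -> pre_rs f a = pre_rs f b.
Proof.
case=> {a b} [V V' j j' u u' g gbij gj <-|V j W g w D e p /dh_specP dg].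
  rewrite (@pre_rsE _ _ f V' j' _ _ _ _ (fprod_pullback _ _)).
  rewrite -rs_comp -rmap_comp; apply: pre_rsE.
  have gjv v : j (g v) = j' v by rewrite -gj.
  have /is_pullbackP[sq ex inj] := fprod_pullback f j'.
  have [g' gK g'K] := gbij.
  apply/is_pullbackP; split=> [w|x v e|w w' e /(bij_inj gbij)]; last exact: inj.
    by rewrite sq -gjv.
  have [|z [zx zv]] := ex x (g' v); first by rewrite -gjv g'K.
  by exists z; split=> //; rewrite -(g'K v) -zv.
pose W' := fprod g (rmap H (fp2 f j)).
have -> : pre_rs f (SNPre j (tr g w)) =
    sN_cl (SNPre (fp1 f j) (tr (fp2 g (rmap H (fp2 f j)))
                              (rs (fp1 g (rmap H (fp2 f j))) w))).
  rewrite /pre_rs /=; congr (sN_cl (SNPre _ _)); apply: restr_trans.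
  case/is_pullbackP: (fprod_pullback g (rmap H (fp2 f j))) => sq ex inj.
  apply/is_pullbackP; split=> [z|x y xy|z z' e1 e2]; first by rewrite sq.
    by have [|z [zx zy]] := ex y x; [rewrite xy | exists z].
  exact: inj.
rewrite /pre_rs /=.
have pP (d : fprod f (gcomp j p)) : f (val d).1 == j (p (val d).2).
  exact: valP d.
pose p0 (d : fprod f (gcomp j p)) : fprod f j :=
  exist _ ((val d).1, p (val d).2) (pP d).
have p0E a d : p0 (gact a d) = gact a (p0 d).
  by apply: val_inj; rewrite /= gmapE.
have eP (d : fprod f (gcomp j p)) :
    g (e (val d).2) == rmap H (fp2 f j) (p0 d) by rewrite (dh_sq dg).
pose e0 (d : rset H (fprod f (gcomp j p))) : W' :=
  exist _ (e (val d).2, p0 d) (eP d).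
have e0E a d : e0 (gact a d) = gact a (e0 d).
  apply: val_inj; rewrite /= p0E; congr pair.
  by rewrite -[RHS]gmapE.
have -> : rs (rmap H (fp2 f (gcomp j p))) (rs e w) =
    rs (GMap e0E) (rs (fp1 g (rmap H (fp2 f j))) w).
  by rewrite -!rs_comp; congr (rs _ w); apply: gmap_eq.
have -> : fp1 f (gcomp j p) = gcomp (fp1 f j) (GMap p0E) by apply: gmap_eq.
apply/sN_cl_step/sN_gen/dh_specP; split=> [//|d d' e1 e2|v s sE sf].
  have [ex ev] : (val d).1 = (val d').1 /\ p (val d).2 = p (val d').2.
    by have := congr1 val e1; case.
  apply: val_inj; apply: injective_projections => //.
  by apply: (dh_inj dg) => // a; have := congr1 val (e2 a); case.
have [||d [pd dP]] := @dh_sec _ _ _ _ _ _ dg (val v).2 (fun a => (val (s a)).1).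
- by move=> a h; rewrite sE.
- move=> a; have := valP (s a) => /eqP->.
  by have := sf a => /= ->.
have dfP : f (val v).1 == gcomp j p d by rewrite /= pd (eqP (valP v)).
exists (exist _ ((val v).1, d) dfP); split.
  by apply: val_inj; rewrite /= pd -surjective_pairing.
move=> a; apply: val_inj; apply: injective_projections; first exact: dP.
rewrite [RHS]sf; apply: val_inj; rewrite /= gmapE pd.
by [].
Qed.

Lemma distr_pullback (kT : finGroupType) (X Y Z A B : gset kT) (i : gmap X Y)
    (j : gmap Y Z) (f : gmap A X) (g : gmap A B) (h : gmap B Z) :
  distr_spec i j f g h -> is_pullback (gcomp i f) g h j.
Proof.
by case=> sq ex inj uniq sec; apply/is_pullbackP; split.
Qed.

Lemma distr_map (kT : finGroupType) (X Y Z A B T P : gset kT) (i : gmap X Y)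
    (j : gmap Y Z) (f : gmap A X) (g : gmap A B) (h : gmap B Z)
    (t : gmap T Z) (y : gmap P Y) (q : gmap P T) (r : gmap P X) :
  distr_spec i j f g h -> is_pullback y q t j -> (forall x, i (r x) = y x) ->
  exists (b : gmap T B) (a : gmap P A),
    [/\ forall x, h (b x) = t x, forall x, f (a x) = r x,
        forall x, g (a x) = b (q x) & is_pullback q a g b].
Proof.
case=> sq ex inj uniq sec /is_pullbackP[psq pex pinj] ir.
have [|||b bP] := @gmap_choice _ T B (fun x b => h b = t x /\
    forall a z, g a = b -> q z = x -> i (f a) = y z -> f a = r z).
- move=> x.
  have [|b [hb bP]] := sec (t x) (fun v e => r (sval (cid (pex v x e)))).
    by move=> v e; case: cid => z /= [<- _]; apply: ir.
  exists b; split=> // a z ga qz ifa.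
  have e : j (i (f a)) = t x by rewrite ifa psq qz.
  rewrite (bP a _ e ga erefl); case: cid => z' /= [yz' qz']; congr (r _).
  by apply: pinj; rewrite ?qz' ?yz'.
- move=> x b b' [hb bP] [hb' bP']; apply: uniq; first by rewrite hb hb'.
  move=> a a' ga ga' ifa.
  have [|z [yz qz]] := pex (i (f a)) x; first by rewrite -sq ga.
  by rewrite (bP a z) // (bP' a' z) // -ifa.
- move=> c x b [hb bP]; split=> [|a z ga qz ifa]; first by rewrite !gmapE hb.
  rewrite -(gactKV c (f a)) -(gactKV c (r z)); congr (gact c _).
  rewrite -!gmapE; apply: bP; first by rewrite gmapE ga gactK.
    by rewrite gmapE qz gactK.
  by rewrite !gmapE ifa.
have [|||a aP] := @gmap_choice _ P A (fun z a => i (f a) = y z /\ g a = b (q z)).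
- by move=> z; apply: ex; rewrite (bP _).1 psq.
- by move=> z a a' [e1 e2] [e3 e4]; apply: inj; rewrite ?e1 ?e2.
- by move=> c z a [e1 e2]; rewrite !gmapE e1 e2.
exists b, a; split=> [x|x|x|]; first by case: (bP x).
- by case: (aP x) => e1 e2; apply: (bP (q x)).2.
- by case: (aP x).
apply/is_pullbackP; split=> [z|x a' e|z z' qz az]; first by case: (aP z).
  have [|z [yz qz]] := pex (i (f a')) x; first by rewrite -sq -(bP _).1 e.
  exists z; split=> //; have [e1 e2] := aP z.
  by apply: inj; rewrite ?e1 ?e2 // qz e.
by apply: pinj => //; case: (aP z) => <- _; case: (aP z') => <- _; rewrite az.
Qed.

Section NormStep.
Variables (X Y V D D1 E1 D2 E2 : gset gT) (f : gmap X Y) (j : gmap V X).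
Variables (W : gset hT) (g : gmap W (rset H V)) (e : gmap (rset H D) W).
Variables (p : gmap D V) (dg : dh_spec g e p).
Variables (e1 : gmap E1 V) (k1 : gmap E1 D1) (p1 : gmap D1 Y).
Hypothesis s1 : distr_spec j f e1 k1 p1.
Variables (e2 : gmap E2 D) (k2 : gmap E2 D2) (p2 : gmap D2 Y).
Hypothesis s2 : distr_spec (gcomp j p) f e2 k2 p2.

Local Notation W1 := (fprod g (rmap H e1)).
Local Notation w1 := (fp1 g (rmap H e1)).
Local Notation w2 := (fp2 g (rmap H e1)).
Variables (A B : gset hT) (al : gmap A W1) (be : gmap A B).
Variable ga : gmap B (rset H D1).
Hypothesis s3 : distr_spec w2 (rmap H k1) al be ga.

Lemma norm_step : exists (q : gmap D2 D1) (e' : gmap (rset H D2) B),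
  [/\ dh_spec ga e' q, forall x, p1 (q x) = p2 x &
    forall w : R W, rs e' (nm be (rs al (rs w1 w))) =
                    nm (rmap H k2) (rs (rmap H e2) (rs e w))].
Proof.
have [|q [ka [p1q e1ka k1ka pbq]]] :=
  distr_map (r := gcomp p e2) s1 (distr_pullback s2); first by [].
have sgP (z : rset H E2) : g (e (e2 z)) == rmap H e1 (ka z).
  by rewrite (dh_sq dg) /= e1ka.
pose sg0 (z : rset H E2) : W1 := exist _ (e (e2 z), ka z) (sgP z).
have sg0E a z : sg0 (gact a z) = gact a (sg0 z).
  by apply: val_inj; rewrite /= !gmapE.
pose sg := @GMap _ (rset H E2) W1 sg0 sg0E.
have pbq' : is_pullback (rmap H ka) (rmap H k2) (rmap H q) (rmap H k1).
  case/is_pullbackP: pbq => sq ex inj; apply/is_pullbackP; split=> //.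
    by move=> x y xy; have [z [zx zy]] := ex y x (esym xy); exists z.
  by move=> x x' ? ?; apply: inj.
have [|e' [mu [gae' almu bemu pbe]]] := distr_map (r := sg) s3 pbq'; first by [].
exists q, e'; split=> [|//|w]; last first.
  rewrite /rs /nm (restr_norm (st_str R) pbe) -!restr_comp.
  by congr (norm _ _ (restr _ _ w)); apply: gmap_eq => z; rewrite /= almu.
have e1ka' (z : E2) : e1 (ka z) = p (e2 z) by rewrite e1ka.
have kaP (z : E2) (a1 : E1) : k1 a1 = q (k2 z) -> j (e1 a1) = j (p (e2 z)) ->
    ka z = a1.
  move=> ka1 ja1; apply: (ds_inj s1); last by rewrite k1ka ka1.
  by rewrite e1ka' ja1.
have w1mu (z : rset H E2) : w1 (al (mu z)) = e (e2 z) by rewrite almu.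
have w2mu (z : rset H E2) : w2 (al (mu z)) = ka z by rewrite almu.
split=> [d|d d' qd ed|d1 s sE sga]; first exact: gae'.
  apply: (ds_uniq s2) => [|a a' ka2 ka2' ja]; first by rewrite -!p1q qd.
  have kaa : ka a = ka a'.
    apply: kaP; first by rewrite k1ka ka2 ka2' qd.
    by rewrite e1ka'; apply: esym ja.
  apply: (dh_inj dg) => [|c]; first by rewrite -!e1ka' kaa.
  rewrite -!(gmapE e2) -!w1mu; congr (w1 (al _)).
  apply: (ds_inj s3); first by rewrite !w2mu !gmapE kaa.
  rewrite !bemu; have := ed c; rewrite -ka2 -ka2' -!gmapE.
  by [].
have del (x : X) : f x = p1 d1 -> {dl : D | exists a1 : E1,
    [/\ j (e1 a1) = x, k1 a1 = d1, p dl = e1 a1 & forall c (a : A),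
      w2 (al a) = gact (g := E1) c a1 -> be a = s c ->
      e (gact (g := D) c dl) = w1 (al a)]}.
  move=> fx; apply: cid; have [a1 [ja1 ka1]] := ds_ex s1 fx.
  have exA c : {a : A | w2 (al a) = gact (g := E1) c a1 /\ be a = s c}.
    apply: cid; apply: (ds_ex s3); rewrite sga.
    by rewrite -[LHS]/(k1 (gact c a1)) gmapE ka1.
  pose aA c := sval (exA c).
  have aA2 c : w2 (al (aA c)) = gact (g := E1) c a1 by case: (svalP (exA c)).
  have aAs c : be (aA c) = s c by case: (svalP (exA c)).
  have [||dl [pdl dlP]] := @dh_sec _ _ _ _ _ _ dg (e1 a1) (fun c => w1 (al (aA c))).
  - move=> c h; rewrite -!(gmapE _ h); congr (w1 (al _)).
    apply: (ds_inj s3); last by rewrite gmapE !aAs sE.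
    by rewrite !gmapE !aA2 gactM.
  - move=> c; have /eqP-> := valP (al (aA c)).
    have := aA2 c; rewrite /= => ->; exact: gmapE.
  exists dl, a1; split=> // c a a2 as_; rewrite dlP; congr (w1 _).
  by congr (al _); apply: (ds_inj s3); rewrite ?aA2 ?aAs.
have [|d [pd dP]] := ds_sec s2 (s := fun x ex => sval (del x ex)).
  by move=> x ex; case: (del x ex) => dl /= [a1 [<- _ -> _]].
have delP (z : E2) : k2 z = d -> exists a1 : E1,
    [/\ j (e1 a1) = j (p (e2 z)), k1 a1 = d1, p (e2 z) = e1 a1 &
      forall c (a : A),
      w2 (al a) = gact (g := E1) c a1 -> be a = s c ->
      e (gact (g := D) c (e2 z)) = w1 (al a)].
  move=> kz; have fx : f (j (p (e2 z))) = p1 d1 by rewrite -pd -kz (ds_sq s2).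
  have := dP z _ fx kz erefl; case: (del _ fx) => dl /= [a1 [a b c a']] ->.
  by exists a1; split=> //; rewrite c.
have qd : q d = d1.
  apply: (ds_uniq s1) => [|a a' ka1 ka1' ja]; first by rewrite p1q pd.
  case/is_pullbackP: pbq => _ ex _; have [|z [kz za]] := ex d a; first by [].
  have [a1 [ja1 k1a1 pe2 _]] := delP z kz.
  have -> : a' = a1.
    by apply: (ds_inj s1); rewrite ?k1a1 // ja1 -ja -za e1ka'.
  by rewrite -za e1ka' pe2.
exists d; split=> // c.
apply: (ds_uniq s3) => [|x x' bx bx' wx].
  by rewrite gae' sga -[LHS]/(q (gact c d)) gmapE qd.
case/is_pullbackP: pbe => _ ex _.
have [|z [kz zx]] := ex (gact (g := D2) c d) x; first by [].
pose z0 : E2 := gact (g := E2) c^-1 z.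
have zE : z = gact (g := E2) c z0 by rewrite /z0 gactKV.
have kz0 : k2 z0 = d by rewrite /z0 gmapE; apply: (canLR (@gactK _ D2 c) kz).
have [a1 [ja1 k1a1 pe2 eP]] := delP z0 kz0.
have ka1 : ka z0 = a1 by apply: kaP; rewrite ?kz0 ?qd.
apply: val_inj; apply: injective_projections; last exact: wx.
rewrite -[RHS](eP c x') ?bx' //; last first.
  by rewrite -wx -zx w2mu zE gmapE ka1.
by rewrite -zx -[LHS]/(w1 (al (mu z))) w1mu zE gmapE.
Qed.

End NormStep.

Lemma pre_nm_step X Y (f : gmap X Y) a b :
  sN_step a b -> pre_nm f a = pre_nm f b.
Proof.
case=> {a b} [V V' j j' u u' g gbij gj <-|V j W g w D e p /dh_specP dg].
  have gjv v : j (g v) = j' v by rewrite -gj.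
  rewrite (pre_nmE _ (dprod_distributor j' f)) -rs_comp -rmap_comp.
  apply: pre_nmE; have [g' gK g'K] := gbij.
  have /is_distributorP[sq ex inj uniq sec] := dprod_distributor j' f.
  apply/is_distributorP; split.
  - by move=> a; rewrite sq -gjv.
  - by move=> y b /ex[a [ay ab]]; exists a; rewrite -ay -gjv.
  - by move=> a a'; rewrite !gjv; apply: inj.
  - move=> b b' hb ef; apply: uniq => // a a' ga ga'; rewrite -!gjv => ea.
    by apply: (bij_inj gbij); apply: ef.
  - move=> z s sP; have [|b [hb bP]] := sec z (fun y ey => g' (s y ey)).
      by move=> y ey; rewrite -gjv g'K.
    exists b; split=> // a y ey ga; rewrite gjv => ia.
    by rewrite -(g'K (s y ey)) -(bP a y ey).
have d1 := dprod_distributor j f.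
have d2 := dprod_distributor (gcomp j p) f.
rewrite (pre_nmE _ d1) (pre_nmE _ d2).
have s1 := proj1 (is_distributorP _ _ _ _ _) d1.
have s2 := proj1 (is_distributorP _ _ _ _ _) d2.
set e1 := dp_eval j f in d1 s1 *; set k1 := fp2 f (dp_proj j f) in d1 s1 *.
have d3 := dprod_distributor (fp2 g (rmap H e1)) (rmap H k1).
have s3 := proj1 (is_distributorP _ _ _ _ _) d3.
have [q [e' [dq p1q uE]]] := norm_step dg s1 s2 s3.
have pb : is_pullback (fp2 g (rmap H e1)) (fp1 g (rmap H e1)) g (rmap H e1).
  case/is_pullbackP: (fprod_pullback g (rmap H e1)) => sq ex inj.
  apply/is_pullbackP; split=> // [x y xy|x x' ? ?]; last exact: inj.
  by have [z [zx zy]] := ex y x (esym xy); exists z.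
have E := etrans (congr1 (nm (rmap H k1)) (restr_trans (st_str R) pb w))
  (norm_trans (st_str R) d3 _).
rewrite -uE [nm (rmap H k1) _]E.
rewrite (_ : dp_proj (gcomp j p) f = gcomp (dp_proj j f) q).
  by apply/sN_cl_step/sN_gen/dh_specP.
by apply: gmap_eq => x; apply: esym (p1q x).
Qed.

Implicit Types X Y Z T V P A B D E : gset gT.

Definition sN_tr X Y (f : gmap X Y) : sN_ob X -> sN_ob Y := sN_lift (pre_tr f).
Definition sN_rs X Y (f : gmap X Y) : sN_ob Y -> sN_ob X := sN_lift (pre_rs f).
Definition sN_nm X Y (f : gmap X Y) : sN_ob X -> sN_ob Y := sN_lift (pre_nm f).

Lemma sN_trE X Y (f : gmap X Y) V (j : gmap V X) (u : R (rset H V)) :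
  sN_tr f (sN_cl (SNPre j u)) = sN_cl (SNPre (gcomp f j) u).
Proof. exact: (sN_liftE (@pre_tr_step _ _ f)). Qed.

Lemma sN_rsE X Y (f : gmap X Y) V (j : gmap V Y) (u : R (rset H V))
    P (p : gmap P X) (q : gmap P V) : is_pullback p q j f ->
  sN_rs f (sN_cl (SNPre j u)) = sN_cl (SNPre p (rs (rmap H q) u)).
Proof. by move/pre_rsE<-; apply: (sN_liftE (@pre_rs_step _ _ f)). Qed.

Lemma sN_nmE X Y (f : gmap X Y) V (j : gmap V X) (u : R (rset H V))
    E D (e : gmap E V) (k : gmap E D) (p : gmap D Y) :
  is_distributor j f e k p ->
  sN_nm f (sN_cl (SNPre j u)) =
  sN_cl (SNPre p (nm (rmap H k) (rs (rmap H e) u))).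
Proof. by move/pre_nmE<-; apply: (sN_liftE (@pre_nm_step _ _ f)). Qed.

Lemma sN_ind X (Q : sN_ob X -> Prop) :
  (forall V (j : gmap V X) (u : R (rset H V)), Q (sN_cl (SNPre j u))) ->
  forall c, Q c.
Proof. by move=> QP c; have [[V j u] ->] := sN_cl_ex c. Qed.

Lemma gcompA X Y Z T (f : gmap Z T) (g : gmap Y Z) (h : gmap X Y) :
  gcomp f (gcomp g h) = gcomp (gcomp f g) h.
Proof. exact: gmap_eq. Qed.

Lemma gcomp1 X Y (f : gmap X Y) : gcomp f (gid X) = f.
Proof. exact: gmap_eq. Qed.

Lemma gcomp1l X Y (f : gmap X Y) : gcomp (gid Y) f = f.
Proof. exact: gmap_eq. Qed.

Lemma sN_tr_id X (c : sN_ob X) : sN_tr (gid X) c = c.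
Proof. by elim/sN_ind: c => V j u; rewrite sN_trE gcomp1l. Qed.

Lemma sN_tr_comp X Y Z (g : gmap Y Z) (f : gmap X Y) c :
  sN_tr (gcomp g f) c = sN_tr g (sN_tr f c).
Proof. by elim/sN_ind: c => V j u; rewrite !sN_trE gcompA. Qed.

Lemma sN_rs_id X (c : sN_ob X) : sN_rs (gid X) c = c.
Proof.
elim/sN_ind: c => V j u; rewrite (@sN_rsE _ _ _ _ _ _ _ j (gid V)).
  by rewrite rmap_id rs_id.
by apply/is_pullbackP; split=> // x y /= ->; exists y.
Qed.

Lemma sN_rs_comp X Y Z (g : gmap Y Z) (f : gmap X Y) c :
  sN_rs (gcomp g f) c = sN_rs f (sN_rs g c).
Proof.
elim/sN_ind: c => V j u.
have pb1 := fprod_pullback g j; have pb2 := fprod_pullback f (fp1 g j).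
rewrite (sN_rsE _ pb1) (sN_rsE _ pb2) -rs_comp -rmap_comp; apply: sN_rsE.
case/is_pullbackP: pb1 => sq1 ex1 inj1; case/is_pullbackP: pb2 => sq2 ex2 inj2.
apply/is_pullbackP; split=> [w|x v e|w w' e1 e2].
- by rewrite -[LHS]/(g (f (fp1 f (fp1 g j) w))) sq2 sq1.
- have [w1 [e1 e2]] := ex1 (f x) v e; have [w2 [e3 e4]] := ex2 x w1 (esym e1).
  by exists w2; split=> //; rewrite -e2 -e4.
- by apply: inj2 => //; apply: inj1 => //; rewrite -!sq2 e1.
Qed.

Lemma sN_nm_id X (c : sN_ob X) : sN_nm (gid X) c = c.
Proof.
elim/sN_ind: c => V j u.
rewrite (@sN_nmE _ _ _ _ _ _ _ _ (gid V) (gid V) j).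
  by rewrite !rmap_id nm_id rs_id.
apply/is_distributorP; split=> //.
- by move=> y b /= ->; exists b.
- by move=> b b' jb ef; apply: ef.
- move=> z s sP; exists (s z erefl); split=> [|a y e /= -> ja]; first exact: sP.
  by move: e; rewrite /= -ja sP => e; congr s; rewrite -?e.
Qed.

Lemma is_pullback_sym P X Y Z (p : gmap P X) (q : gmap P Y)
    (i : gmap Y Z) (j : gmap X Z) :
  is_pullback p q i j -> is_pullback q p j i.
Proof.
case/is_pullbackP => sq ex inj; apply/is_pullbackP; split=> //.
  by move=> x y xy; have [z [zx zy]] := ex y x (esym xy); exists z.
by move=> x x' e1 e2; apply: inj.
Qed.

Lemma distr_comp X Y Z V (j : gmap V X) (f : gmap X Y) (g : gmap Y Z)
    E1 D1 (e1 : gmap E1 V) (k1 : gmap E1 D1) (p1 : gmap D1 Y)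
    E2 D2 (e2 : gmap E2 D1) (k2 : gmap E2 D2) (p2 : gmap D2 Z) :
  distr_spec j f e1 k1 p1 -> distr_spec p1 g e2 k2 p2 ->
  distr_spec j (gcomp g f) (gcomp e1 (fp1 k1 e2)) (gcomp k2 (fp2 k1 e2)) p2.
Proof.
move=> [sq1 ex1 inj1 uniq1 sec1] [sq2 ex2 inj2 uniq2 sec2].
have [sq ex inj] := proj1 (is_pullbackP _ _ _ _) (fprod_pullback k1 e2).
split.
- by move=> a; rewrite -[LHS]/(p2 (k2 (fp2 k1 e2 a))) sq2 -sq sq1.
- move=> x b e; have [a2 [e2x k2b]] := ex2 (f x) b e.
  have [a1 [e1x k1b]] := ex1 x (e2 a2) (esym e2x).
  by have [a [aa1 aa2]] := ex a1 a2 k1b; exists a; rewrite /= -e1x -k2b -aa1 -aa2.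
- move=> a a' ja ka.
  have e2a : fp2 k1 e2 a = fp2 k1 e2 a'.
    apply: inj2 => //; rewrite -!sq !sq1; congr (f _); exact: ja.
  by apply: inj => //; apply: inj1 => //; rewrite !sq e2a.
- move=> b b' pb ef; apply: uniq2 => // a2 a2' ka ka' pa.
  apply: uniq1 => // a1 a1' kb kb' ja.
  have [a [aa1 aa2]] := ex _ _ kb; have [a' [aa1' aa2']] := ex _ _ kb'.
  rewrite -aa1 -aa1'; apply: ef; first by rewrite -ka -aa2.
    by rewrite -ka' -aa2'.
  by move: ja; rewrite -aa1 -aa1'.
move=> z s sP.
have s1 y : g y = z -> {d : D1 | p1 d = y /\ forall a x (e : g (f x) = z),
    k1 a = d -> j (e1 a) = x -> e1 a = s x e}.
  move=> gy; apply: cid.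
  have gfx x (e : f x = y) : g (f x) = z by rewrite e.
  have [|d [pd dP]] := sec1 y (fun x e => s x (gfx x e)).
    by move=> x e; apply: sP.
  exists d; split=> // a x e ka ja.
  have fx : f x = y by rewrite -ja -sq1 ka.
  by rewrite (dP a x fx) //; congr s; apply: Prop_irrelevance.
have [|b [pb bP]] := sec2 z (fun y e => sval (s1 y e)).
  by move=> y e; case: (s1 y e) => d [].
exists b; split=> // a x e ka ja.
have := bP (fp2 k1 e2 a) (f x) e ka.
case: (s1 _ e) => d /= [pd dP] => h; apply: (dP (fp1 k1 e2 a)) => //.
by rewrite sq h // -sq sq1; congr (f _).
Qed.

Lemma sN_nm_comp X Y Z (g : gmap Y Z) (f : gmap X Y) c :
  sN_nm (gcomp g f) c = sN_nm g (sN_nm f c).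
Proof.
elim/sN_ind: c => V j u.
have d1 := dprod_distributor j f.
have d2 := dprod_distributor (dp_proj j f) g.
have s1 := proj1 (is_distributorP _ _ _ _ _) d1.
have s2 := proj1 (is_distributorP _ _ _ _ _) d2.
have d3 := proj2 (is_distributorP _ _ _ _ _) (distr_comp s1 s2).
rewrite (sN_nmE _ d1) (sN_nmE _ d2) (sN_nmE _ d3); congr (sN_cl (SNPre _ _)).
rewrite !rmap_comp /nm /rs norm_comp restr_comp.
by rewrite (restr_norm (st_str R) (rmap_pullback
     (is_pullback_sym (fprod_pullback _ _)))).
Qed.

Lemma sN_rs_tr P X Y Z (p : gmap P X) (q : gmap P Y)
    (i : gmap Y Z) (j : gmap X Z) : is_pullback p q i j ->
  forall c, sN_rs j (sN_tr i c) = sN_tr p (sN_rs q c).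
Proof.
move=> pb; elim/sN_ind => V k u; have pb' := fprod_pullback q k.
rewrite sN_trE (sN_rsE _ pb') sN_trE; apply: sN_rsE.
case/is_pullbackP: pb => sq ex inj; case/is_pullbackP: pb' => sq' ex' inj'.
apply/is_pullbackP; split=> [w|x v e|w w' e1 e2].
- by rewrite -[LHS]/(j (p (fp1 q k w))) sq sq'.
- have [w [e1 e2]] := ex x (k v) e; have [w' [e3 e4]] := ex' w v e2.
  by exists w'; split=> //; rewrite -e1 -e3.
- by apply: inj' => //; apply: inj => //; rewrite !sq' e2.
Qed.

Lemma sN_nm_tr X Y Z A B (i : gmap X Y) (j : gmap Y Z)
    (f : gmap A X) (g : gmap A B) (h : gmap B Z) :
  is_distributor i j f g h ->
  forall c, sN_nm j (sN_tr i c) = sN_tr h (sN_nm g (sN_rs f c)).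
Proof.
move=> /is_distributorP ds; elim/sN_ind => V k u.
have pb := fprod_pullback f k; have d1 := dprod_distributor (fp1 f k) g.
rewrite (sN_rsE _ pb) (sN_nmE _ d1) !sN_trE.
rewrite -rs_comp -rmap_comp; apply: sN_nmE; apply/is_distributorP.
case/is_distributorP: d1 => sq1 ex1 inj1 uniq1 sec1.
case: ds => sq ex inj uniq sec; case/is_pullbackP: pb => psq pex pinj.
set e := dp_eval _ _ in sq1 ex1 inj1 uniq1 sec1 *.
set kk := fp2 _ _ in sq1 ex1 inj1 uniq1 sec1 *.
set p := dp_proj _ _ in kk sq1 ex1 inj1 uniq1 sec1 *.
have ikE a : gcomp i k (gcomp (fp2 f k) e a) = i (f (fp1 f k (e a))).
  by rewrite psq.
split.
- by move=> a; rewrite ikE -sq -sq1.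
- move=> y d jy; have [a [ifa ga]] := ex y (p d) jy.
  by have [c [ec kc]] := ex1 a d ga; exists c; rewrite ikE ec.
- move=> a a'; rewrite !ikE => ia ka; apply: inj1 => //; apply: inj => //.
  by rewrite -!sq1 ka.
- move=> b b' hb ef.
  have pb : p b = p b'.
    apply: uniq => // a a' ga ga' ia.
    have [c [ec kc]] := ex1 a b ga; have [c' [ec' kc']] := ex1 a' b' ga'.
    have := ef c c' kc kc'; rewrite !ikE ec ec' => /(_ ia) e2.
    by rewrite -ec -ec' !psq; congr (k _).
  apply: uniq1 => // a a' ka ka' ea; apply: pinj => //.
  by apply: ef => //; rewrite !ikE ea.
move=> z s sP.
have [|b [hb bP]] := sec z (fun y e => k (s y e)).
  by move=> y ey; apply: sP.
have jz a : g a = b -> j (i (f a)) = z by move=> ga; rewrite -sq ga.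
have s0 a : g a = b -> {v | fp1 f k v = a /\ forall e, fp2 f k v = s (i (f a)) e}.
  move=> ga; apply: cid.
  have [|v [v1 v2]] := pex a (s _ (jz a ga)); first exact: bP.
  by exists v; split=> // e0; rewrite v2; congr s; apply: Prop_irrelevance.
have [|d [pd dP]] := sec1 b (fun a ga => sval (s0 a ga)).
  by move=> a ga; case: (s0 a ga) => v [].
exists d; split=> [|c y jy kc]; first by rewrite -hb -pd.
rewrite ikE => iy; move: jy; rewrite -{y}iy => jy.
have gc : g (fp1 f k (e c)) = b by rewrite -sq1 kc.
have := dP c _ gc kc erefl; case: (s0 _ gc) => v /= [_ vP] ev.
by apply: etrans (congr1 (fp2 f k) ev) _; apply: vP.
Qed.

Lemma sN_rs_nm P X Y Z (p : gmap P X) (q : gmap P Y)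
    (i : gmap Y Z) (j : gmap X Z) : is_pullback p q i j ->
  forall c, sN_rs j (sN_nm i c) = sN_nm p (sN_rs q c).
Proof.
move=> pb; elim/sN_ind => V k u; have pb1 := fprod_pullback q k.
have d1 := dprod_distributor k i.
rewrite (sN_rsE _ pb1) (sN_nmE _ d1) (sN_rsE _ (fprod_pullback j _)).
set e := dp_eval _ _ in d1 *; set pd := dp_proj _ _ in d1 *.
set kk := fp2 i pd in d1 *.
have pb2 := fprod_pullback j pd; have pb3 := fprod_pullback kk (fp2 j pd).
case/is_distributorP: d1 => sq1 ex1 inj1 uniq1 sec1.
case/is_pullbackP: (pb) => sq ex inj.
case/is_pullbackP: (pb1) => bsq bex binj.
case/is_pullbackP: (pb2) => csq cex cinj.
case/is_pullbackP: (pb3) => dsq dex dinj.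
have [|||e' e'P] := @gmap_choice _ (fprod kk (fp2 j pd)) (fprod q k)
    (fun w v => fp2 q k v = e (fp1 kk (fp2 j pd) w) /\
       p (fp1 q k v) = fp1 j pd (fp2 kk (fp2 j pd) w)).
- move=> w; have [|x [x1 x2]] := ex (fp1 j pd (fp2 kk (fp2 j pd) w))
      (k (e (fp1 kk (fp2 j pd) w))); first by rewrite csq -dsq sq1.
  by have [v [v1 v2]] := bex x _ x2; exists v; rewrite v1 v2.
- move=> w v v' [v1 v2] [v1' v2']; apply: binj; last by rewrite v1 v1'.
  by apply: inj; rewrite ?v2 ?v2' // !bsq v1 v1'.
- by move=> a w v [v1 v2]; rewrite !gmapE v1 v2.
rewrite (@sN_nmE _ _ _ _ _ _ _ _ e' (fp2 kk (fp2 j pd)) (fp1 j pd)).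
  congr (sN_cl (SNPre _ _)).
  rewrite /nm /rs (restr_norm (st_str R) (rmap_pullback
     (is_pullback_sym pb3))) -!restr_comp -!rmap_comp.
  congr (norm _ _ (restr _ (rmap H _) u)); apply: gmap_eq => w.
  by case: (e'P w) => e1 _; apply: esym.
have qe w : q (fp1 q k (e' w)) = k (e (fp1 kk (fp2 j pd) w)).
  by rewrite bsq (e'P w).1.
apply/is_distributorP; split.
- by move=> w; rewrite (e'P w).2.
- move=> x d px; have [|a [ka kd]] := ex1 (q x) (fp2 j pd d).
    by rewrite -csq -px sq.
  have [w [w1 w2]] := dex a d kd; exists w; split=> //.
  by apply: inj; rewrite ?qe ?w1 // (e'P w).2 w2.
- move=> w w' xe dw; apply: dinj => //; apply: inj1.
    by rewrite -!qe xe.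
  by rewrite !dsq dw.
- move=> d d' xd ef; apply: cinj => //; apply: uniq1 => [|a a' ka ka' ke].
    by rewrite -!csq xd.
  have [w [w1 w2]] := dex a d ka; have [w' [w1' w2']] := dex a' d' ka'.
  have := ef w w' w2 w2' => h.
  rewrite -w1 -w1' -(e'P w).1 -(e'P w').1 h //; apply: inj.
    by rewrite (e'P w).2 (e'P w').2 w2 w2'.
  by rewrite !qe w1 w1'.
move=> x s sP.
have s0 y : i y = j x -> {v | k v = y /\ forall t (e : p t = x), q t = y ->
    v = fp2 q k (s t e)}.
  move=> iy; apply: cid; have [t [pt qt]] := ex x y (esym iy).
  exists (fp2 q k (s t pt)); split; first by rewrite -bsq sP.
  move=> t' pt' qt'; have tt' : t = t' by apply: inj; rewrite ?pt ?qt.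
  by subst t'; congr (fp2 q k (s t _)); apply: Prop_irrelevance.
have [|b [hb bP]] := sec1 (j x) (fun y e => sval (s0 y e)).
  by move=> y iy; case: (s0 y iy) => v [].
have [d [d1 d2]] := cex x b (esym hb).
exists d; split=> // w t pt wd et.
have iq : i (q t) = j x by rewrite -sq pt.
have := bP (fp1 kk (fp2 j pd) w) _ iq; rewrite dsq wd => /(_ d2).
rewrite -qe et => /(_ erefl); case: (s0 _ iq) => v /= [_ vP].
rewrite (vP t pt erefl) => es; apply: binj; first by rewrite et sP.
exact: etrans (e'P w).1 es.
Qed.

Lemma st_empty_eq (X : gset hT) : (X -> False) -> forall u v : R X, u = v.
Proof.
move=> X0 u v.
have kE a (x : X) : False_rect (@gempty hT) (X0 (gact a x)) =
    gact a (False_rect (@gempty hT) (X0 x)) by case: (X0 x).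
have k'E a (w : @gempty hT) : False_rect X (match w with end) =
    gact a (False_rect X (match w with end)) by case: w.
pose k := @GMap _ X gempty _ kE; pose k' : gmap gempty X := GMap k'E.
have k'k : gcomp k' k = gid X by apply: gmap_eq => x; case: (X0 x).
have [w [_ wP]] := restr_empty (st_str R).
by rewrite -(rs_id u) -(rs_id v) -k'k !rs_comp -(wP (rs k' u)) // -(wP (rs k' v)).
Qed.

Lemma sN_empty : exists! c : sN_ob gempty, True.
Proof.
have [u0] := st_nonempty (st_str R) (rset H gempty).
exists (sN_cl (SNPre (gid gempty) u0)); split=> // c _.
elim/sN_ind: c => V j u.
have V0 (v : V) : False by case: (j v).
have kE a (w : @gempty gT) : False_rect V (match w with end) =
    gact a (False_rect V (match w with end)) by case: w.
apply/esym; apply: (SNPre_iso (f := @GMap _ gempty V _ kE)) => [|[]|].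
- by exists j => [[]|v]; case: (V0 v).
- by apply: st_empty_eq => -[].
Qed.

Lemma sN_inhabited X : inhabited (sN_ob X).
Proof.
have [u0] := st_nonempty (st_str R) (rset H gempty).
have kE a (w : @gempty gT) : (match w return X with end) =
  gact a (match w return X with end) by case: w.
exact: (inhabits (sN_cl (SNPre (GMap kE) u0))).
Qed.

Section Glue.

Definition gsum_map (kT : finGroupType) (X X' Y Y' : gset kT) (f : gmap X X')
  (g : gmap Y Y') : gmap (gsum X Y) (gsum X' Y').
Proof.
refine (@GMap _ (gsum X Y) (gsum X' Y')
  (fun w => match w with inl x => inl (f x) | inr y => inr (g y) end) _).
by move=> a [x|y] /=; rewrite gmapE.
Defined.

Lemma glue_ex V1 V2 (u1 : R (rset H V1)) (u2 : R (rset H V2)) :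
  exists! w : R (rset H (gsum V1 V2)),
    rs (rmap H (ginl V1 V2)) w = u1 /\ rs (rmap H (ginr V1 V2)) w = u2.
Proof.
apply: is_coprod_restr => //.
- by move=> x y; apply: inl_inj.
- by move=> x y; apply: inr_inj.
- by case=> z; [left|right]; exists z.
Qed.

Definition glue V1 V2 (u1 : R (rset H V1)) (u2 : R (rset H V2)) :
  R (rset H (gsum V1 V2)) := sval (cid (glue_ex u1 u2)).

Lemma glue_l V1 V2 (u1 : R (rset H V1)) (u2 : R (rset H V2)) :
  rs (rmap H (ginl V1 V2)) (glue u1 u2) = u1.
Proof. by rewrite /glue; case: cid => w [[]]. Qed.

Lemma glue_r V1 V2 (u1 : R (rset H V1)) (u2 : R (rset H V2)) :
  rs (rmap H (ginr V1 V2)) (glue u1 u2) = u2.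
Proof. by rewrite /glue; case: cid => w [[]]. Qed.

Lemma glue_uniq V1 V2 (u1 : R (rset H V1)) (u2 : R (rset H V2)) w :
  rs (rmap H (ginl V1 V2)) w = u1 -> rs (rmap H (ginr V1 V2)) w = u2 ->
  w = glue u1 u2.
Proof.
move=> e1 e2; rewrite /glue; case: cid => w' /= [_ wP].
by rewrite (wP w).
Qed.

Definition pre_glue X Y (a : sN_pre X) (b : sN_pre Y) : sN_ob (gsum X Y) :=
  sN_cl (SNPre (gsum_map (sN_j a) (sN_j b)) (glue (sN_u a) (sN_u b))).

Lemma pre_glue_step X Y (a a' : sN_pre X) (b : sN_pre Y) :
  sN_step a a' -> pre_glue a b = pre_glue a' b.
Proof.
case: b => V2 j2 u2.
case=> {a a'} [V V' j j' u u' f fbij fj <-|V j W g w D e p /dh_specP dg].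
  have fjv v : j (f v) = j' v by rewrite -fj.
  apply: (SNPre_iso (f := gsum_map f (gid V2))) => /=.
  - have [k fK kK] := fbij.
    exists (fun w => match w with inl x => inl (k x) | inr y => inr y end).
      by case=> x //=; rewrite fK.
    by case=> x //=; rewrite kK.
  - by case=> x //=; rewrite fjv.
  - apply: glue_uniq; rewrite -rs_comp -rmap_comp.
      rewrite -[in RHS](glue_l u u2) -rs_comp -rmap_comp.
      by congr (rs (rmap H _) _); apply: gmap_eq.
    rewrite -[in RHS](glue_r u u2); congr (rs (rmap H _) _).
    exact: gmap_eq.
have [x [[x1 x2] _]] := restr_sum (st_str R) w u2.
have GE a (z : gsum W (rset H V2)) :
  (match gact a z with inl y => inl (g y) | inr y => inr y end : gsum V V2) =
  gact (g := rset H (gsum V V2)) a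
    (match z with inl y => inl (g y) | inr y => inr y end).
  by case: z => z /=; rewrite ?gmapE.
pose G := @GMap _ (gsum W (rset H V2)) (rset H (gsum V V2)) _ GE.
have eE a (z : rset H (gsum D V2)) :
  (match gact a z with inl y => inl (e y) | inr y => inr y end
    : gsum W (rset H V2)) =
  gact (g := gsum W (rset H V2)) a
    (match z with inl y => inl (e y) | inr y => inr y end).
  case: z => z //=; congr inl; exact: (gmapE e).
pose e' := @GMap _ (rset H (gsum D V2)) (gsum W (rset H V2)) _ eE.
have uE : glue (tr g w) u2 = tr G x.
  have pbl : is_pullback g (ginl W (rset H V2)) G (rmap H (ginl V V2)).
    apply/is_pullbackP; split=> // [y z|z z' _ ez]; last exact: inl_inj ez.
    by case: z => z //= ez; exists z; rewrite (@inl_inj V V2 _ _ ez).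
  have pbr : is_pullback (gid _) (ginr W (rset H V2)) G (rmap H (ginr V V2)).
    apply/is_pullbackP; split=> // y z.
    by case: z => z //= ez; exists z; rewrite (@inr_inj V V2 _ _ ez).
  apply/esym/glue_uniq; first by rewrite -x1; apply: (restr_trans (st_str R) pbl).
  by rewrite -[RHS]tr_id -x2; apply: (restr_trans (st_str R) pbr).
have uE' : glue (rs e w) u2 = rs e' x.
  apply/esym/glue_uniq; rewrite -rs_comp.
    rewrite -x1 /rs -restr_comp; congr (restr _ _ x); exact: gmap_eq.
  rewrite -[in RHS]x2; congr (restr _ _ x); exact: gmap_eq.
rewrite /pre_glue /= uE uE'.
have -> : gsum_map (gcomp j p) j2 =
    gcomp (gsum_map j j2) (gsum_map p (gid V2)).
  by apply: gmap_eq => -[].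
apply/sN_cl_step/sN_gen/dh_specP; split.
- by case=> d //=; rewrite (dh_sq dg).
- case=> d [d'|d'] //= [pd] ed.
    congr inl; apply: (dh_inj dg) => // a.
    by have [] := ed a.
  by rewrite pd.
- case=> v s sE sg.
    have s1 a : {y | s a = inl y}.
      by apply: cid; have := sg a; case: (s a) => // y _; exists y.
    have [||d [pd dP]] := @dh_sec _ _ _ _ _ _ dg v (fun a => sval (s1 a)).
    - move=> a h; case: (s1 _) => y /= ey; case: (s1 a) => z /= ez.
      by have := sE a h; rewrite ey ez => -[].
    - by move=> a; have := sg a; case: (s1 a) => y /= -> [].
    exists (inl d); split=> [|a] /=; first by rewrite pd.
    by rewrite dP; case: (s1 a).
  exists (inr v); split=> // a /=; have := sg a.
  by case: (s a) => // y [->].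
Qed.

Definition gswap X Y : gmap (gsum X Y) (gsum Y X).
Proof.
refine (@GMap _ (gsum X Y) (gsum Y X)
  (fun w => match w with inl x => inr x | inr y => inl y end) _).
by move=> a [].
Defined.

Lemma pre_glue_swap X Y (a : sN_pre X) (b : sN_pre Y) :
  pre_glue a b = sN_tr (gswap Y X) (pre_glue b a).
Proof.
rewrite /pre_glue sN_trE; case: a b => V1 j1 u1 [V2 j2 u2] /=.
apply: (SNPre_iso (f := gswap V2 V1)).
- by exists (gswap V1 V2) => -[].
- by case.
- apply: glue_uniq; rewrite -rs_comp -rmap_comp.
    by rewrite -[RHS](glue_r u1 u2); congr (rs (rmap H _) _); apply: gmap_eq.
  by rewrite -[RHS](glue_l u1 u2); congr (rs (rmap H _) _); apply: gmap_eq.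
Qed.

Lemma pre_glue_eq X Y (a a' : sN_pre X) (b b' : sN_pre Y) :
  sN_cl a = sN_cl a' -> sN_cl b = sN_cl b' -> pre_glue a b = pre_glue a' b'.
Proof.
have eql X' Y' (c c' : sN_pre X') (d : sN_pre Y') :
    sN_cl c = sN_cl c' -> pre_glue c d = pre_glue c' d.
  move/sN_clP; elim=> [x y /pre_glue_step|//|x y _ ->//|x y z _ -> _ ->//].
  exact.
by move=> ea eb; rewrite (eql _ _ _ _ _ ea) pre_glue_swap (eql _ _ _ _ _ eb)
  -pre_glue_swap.
Qed.

Lemma pre_glueE X Y V (j : gmap V (gsum X Y)) (u : R (rset H V)) P Q
    (p : gmap P X) (p' : gmap P V) (q : gmap Q Y) (q' : gmap Q V) :
  is_pullback p p' j (ginl X Y) -> is_pullback q q' j (ginr X Y) ->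
  sN_cl (SNPre j u) = pre_glue (SNPre p (rs (rmap H p') u))
                               (SNPre q (rs (rmap H q') u)).
Proof.
case/is_pullbackP => sq1 ex1 inj1 /is_pullbackP[sq2 ex2 inj2].
pose k0 (w : gsum P Q) : V := match w with inl x => p' x | inr y => q' y end.
have k0E a w : k0 (gact a w) = gact a (k0 w) by case: w => w; apply: gmapE.
apply: (SNPre_iso (f := @GMap _ (gsum P Q) V k0 k0E)) => /=.
- have kex v : exists w, k0 w = v.
    case jv : (j v) => [x|y].
      by have [w [_ <-]] := ex1 x v (esym jv); exists (inl w).
    by have [w [_ <-]] := ex2 y v (esym jv); exists (inr w).
  have kinj : injective k0.
    case=> w [w'|w'] /= e; first last.
    - congr inr; apply: inj2 => //; apply: inr_inj.
      by have := congr1 j e; rewrite -!sq2; apply.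
    - by have := congr1 j e; rewrite -sq1 -sq2.
    - by have := congr1 j e; rewrite -sq1 -sq2.
    - congr inl; apply: inj1 => //; apply: inl_inj.
      by have := congr1 j e; rewrite -!sq1; apply.
  exists (fun v => sval (cid (kex v))) => [w|v]; case: cid => //= w'.
  exact: kinj.
- by case=> w /=; rewrite -?sq1 -?sq2.
- apply: glue_uniq; rewrite -rs_comp -rmap_comp;
    congr (rs (rmap H _) _); exact: gmap_eq.
Qed.

End Glue.

Lemma sN_sum X Y (u : sN_ob X) (v : sN_ob Y) :
  exists! w : sN_ob (gsum X Y),
    sN_rs (ginl X Y) w = u /\ sN_rs (ginr X Y) w = v.
Proof.
have [a ->] := sN_cl_ex u; have [b ->] := sN_cl_ex v.
exists (pre_glue a b); split.
  case: a b => V1 j1 u1 [V2 j2 u2]; rewrite /pre_glue /=; split.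
    rewrite (@sN_rsE _ _ _ _ _ _ _ j1 (ginl V1 V2)) ?glue_l //.
    apply/is_pullbackP; split=> // [x [w|w] //= [e]|w w' _ [] //].
    by exists w; rewrite e.
  rewrite (@sN_rsE _ _ _ _ _ _ _ j2 (ginr V1 V2)) ?glue_r //.
  apply/is_pullbackP; split=> // [x [w|w] //= [e]|w w' _ [] //].
  by exists w; rewrite e.
elim/sN_ind => V j w.
have pb1 := fprod_pullback (ginl X Y) j.
have pb2 := fprod_pullback (ginr X Y) j.
rewrite (sN_rsE _ pb1) (sN_rsE _ pb2) (pre_glueE _ pb1 pb2) => -[e1 e2].
exact: pre_glue_eq.
Qed.

Definition sN_str : semi_tambara_on sN_ob :=
  @SemiTambaraOn gT sN_ob sN_rs sN_tr sN_nm sN_inhabited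
    sN_rs_id sN_rs_comp sN_tr_id sN_tr_comp sN_nm_id sN_nm_comp
    sN_empty sN_sum sN_rs_tr sN_rs_nm sN_nm_tr.

Definition sN_st : semi_tambara gT := SemiTambara sN_str.

End NormObject.

Section NormFunctor.
Variables (gT : finGroupType) (H : {group gT}).
Local Notation hT := (sub_gT H).
Implicit Types R S T : semi_tambara hT.

Definition pre_map R S (phi : st_hom R S) X (a : sN_pre R X) : sN_ob S X :=
  sN_cl (SNPre (sN_j a) (phi _ (sN_u a))).

Definition sN_map R S (phi : st_hom R S) X : sN_ob R X -> sN_ob S X :=
  sN_lift (@pre_map R S phi X).

Lemma sN_mapE R S (phi : st_hom R S) X V (j : gmap V X) (u : R (rset H V)) :
  sN_map phi (sN_cl (SNPre j u)) = sN_cl (SNPre j (phi _ u)).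
Proof.
apply: (@sN_liftE _ _ R X _ (@pre_map R S phi X)) => a b.
case=> {V j u a b} [V V' j j' u u' f fbij fj <-|V j W f w D e p dg].
  by apply/sN_cl_step/(sN_iso fbij fj); rewrite st_fun_rs.
by apply/sN_cl_step; rewrite st_fun_tr st_fun_rs; apply: sN_gen.
Qed.

Section Map.
Variables (R S : semi_tambara hT) (phi : st_hom R S).

Lemma sN_map_rs X Y (f : gmap X Y) (c : sN_st R Y) :
  @sN_map R S phi X (rs f c) = rs (R := sN_st S) f (sN_map phi c).
Proof.
elim/sN_ind: c => V j u; rewrite /rs /= (sN_rsE _ (fprod_pullback _ _)).
by rewrite !sN_mapE (sN_rsE _ (fprod_pullback _ _)) st_fun_rs.
Qed.

Lemma sN_map_tr X Y (f : gmap X Y) (c : sN_st R X) :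
  @sN_map R S phi Y (tr f c) = tr (R := sN_st S) f (sN_map phi c).
Proof.
by elim/sN_ind: c => V j u; rewrite /tr /= sN_trE !sN_mapE sN_trE.
Qed.

Lemma sN_map_nm X Y (f : gmap X Y) (c : sN_st R X) :
  @sN_map R S phi Y (nm f c) = nm (R := sN_st S) f (sN_map phi c).
Proof.
elim/sN_ind: c => V j u; rewrite /nm /= (sN_nmE _ (dprod_distributor _ _)).
by rewrite !sN_mapE (sN_nmE _ (dprod_distributor _ _)) st_fun_nm st_fun_rs.
Qed.

Definition sN_hom : st_hom (sN_st R) (sN_st S) :=
  @StHom _ (sN_st R) (sN_st S) (@sN_map R S phi)
    sN_map_rs sN_map_tr sN_map_nm.

End Map.

Lemma sN_hom_id R : sN_hom (st_id R) = st_id (sN_st R).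
Proof.
by apply: st_hom_eq => X c; elim/sN_ind: c => V j u; apply: sN_mapE.
Qed.

Lemma sN_hom_comp R S T (f : st_hom S T) (g : st_hom R S) :
  sN_hom (st_comp f g) = st_comp (sN_hom f) (sN_hom g).
Proof.
by apply: st_hom_eq => X c; elim/sN_ind: c => V j u; rewrite /= !sN_mapE.
Qed.

Definition sN : functor (sTamb hT) (sTamb gT) :=
  @Functor (sTamb hT) (sTamb gT) (@sN_st gT H) sN_hom
    sN_hom_id sN_hom_comp.

End NormFunctor.

(* Main.v *)
Require Import Defs.
From mathcomp Require Import all_boot all_fingroup.

(** The unit and the counit are checked directly: both are given by norms, along
[X -> Res (G x_H X)] and [G x_H Res V -> V], so each compatibility but
one is an instance of functoriality, of base change, or of the distributor formula.

Base change along a map [f] applies because the naturality squares of the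
set-level unit and counit are pullbacks ([ind_unit_pullback],
[ind_counit_pullback]).  The generating relation of [sN R] is an instance of the
distributor formula of the target once [t_j n_(eps_V)] is applied, so [eps] is
well defined ([counit_pre_step]).

The only compatibility with real content is that of [eta] with the transfer
along [f : X -> Y] ([unit_tr]).  Let [(f', g, h)], with
[f' : A -> X], [g : A -> B] and [h : B -> Res (G x_H Y)], be a distributor for
[f] and the inclusion [eta_Y : Y -> Res (G x_H Y)]; then
[n_(eta_Y) t_f = t_h n_g r_f'].  The inclusion being injective, [B] has over
[eta_Y y] the fibre of [f] at [y], and over a point outside the image of [eta_Y]
a single point.  So an H-map [s : G -> B] over the orbit map of [v = [k, y]] is
determined by [s (k^-1)], a point of the fibre of [f] at [y]; such pairs [(v, s)]
are the elements [[k, x]] of [G x_H X].  Thus [D_H(B, h, G x_H Y)] is [G x_H X]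
with projection [G x_H f] ([unit_dh_spec]), and the generating relation of
[sN R] turns [(id, t_h n_g r_f' u)] into [(G x_H f, n_(eta_X) u)].

The triangle identities reduce, by functoriality of the norm, to those of
the induction/restriction adjunction on sets. *)

Set Implicit Arguments.
Unset Strict Implicit.
Unset Printing Implicit Defensive.

Local Open Scope group_scope.

(* [gact] denotes the action on a [gset], not that of a [groupAction]. *)
Local Notation gact := Defs.gact.

(** * Pullbacks and distributors *)

Section Squares.
Variable gT : finGroupType.
Implicit Types P X Y Z : gset gT.

Lemma is_pullback_sym P X Y Z (p : gmap P X) (q : gmap P Y) (i : gmap Y Z)
    (j : gmap X Z) : is_pullback p q i j -> is_pullback q p j i.
Proof.
case/is_pullbackP => sq ex inj; apply/is_pullbackP; split=> [w|x y /esym|w w'].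
- by rewrite sq.
- by case/ex => w [pw qw]; exists w.
- by move=> qe pe; apply: inj.
Qed.

Lemma gid_distributor X Y (f : gmap X Y) :
  is_distributor (gid X) f (gid X) f (gid Y).
Proof.
apply/is_distributorP; split=> //= [x y e|z s sP]; first by exists x.
by exists z; split=> // a y e fa ay; rewrite sP.
Qed.

Lemma tr_rs_bij (R : semi_tambara gT) X Y (f : gmap X Y) (u : R Y) :
  bijective f -> tr f (rs f u) = u.
Proof.
move=> fbij; have pb : is_pullback f f (gid Y) (gid Y).
  have [f' fK f'K] := fbij.
  apply/is_pullbackP; split=> // [x y /= ->|w w' + _]; last exact: bij_inj.
  by exists (f' y).
by rewrite /tr -(restr_trans (st_str R) pb) restr_id trans_id.
Qed.

End Squares.

Section Adjunction.
Variables (gT : finGroupType) (H : {group gT}).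
Local Notation hT := (sub_gT H).

Lemma ind_unit_pullback (X Y : gset hT) (f : gmap X Y) :
  is_pullback (ind_unit X) f (ind_unit Y) (rmap H (imap f)).
Proof.
apply/is_pullbackP; split=> [x|w y|x x' /icl_inj //]; first exact: imapE.
by case/imap_lift => x [-> fx]; exists x.
Qed.

Lemma ind_counit_pullback (V W : gset gT) (f : gmap V W) :
  is_pullback (ind_counit H V) (imap (rmap H f)) (ind_counit H W) f.
Proof.
apply/is_pullbackP; split=> [w|v w|w w'].
- have [g [v ->]] := icl_ex w.
  by rewrite imapE !ind_counitE gmapE.
- have [g [x ->]] := icl_ex w; rewrite ind_counitE => fv.
  exists (icl g (gact (g := V) g^-1 v : rset H V)).
  by rewrite imapE ind_counitE gactKV /= gmapE fv gactK.
- have [g [v ->]] := icl_ex w; move=> ev; rewrite imapE => /esym.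
  case/imap_lift => v' [ew' _]; move: ev; rewrite ew' !ind_counitE => ev.
  by congr icl; rewrite -(gactK g (v : V)) ev gactK.
Qed.

(** * The unit *)

Section Unit.
Variable R : semi_tambara hT.

(** The unit at [X], with values in [(Res (sN R)) X = (sN R) (G x_H X)]. *)
Definition unit_fun (X : gset hT) (u : R X) : sN_ob R (iset X) :=
  sN_cl (SNPre (gid (iset X)) (nm (ind_unit X) u)).

Lemma unit_rs (X Y : gset hT) (f : gmap X Y) (u : R Y) :
  unit_fun (rs f u) = sN_rs (imap f) (unit_fun u).
Proof.
have pb : is_pullback (gid (iset X)) (imap f) (gid (iset Y)) (imap f).
  by apply/is_pullbackP; split=> // x y /= <-; exists x.
rewrite /unit_fun (sN_rsE _ pb); congr (sN_cl (SNPre _ _)).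
exact: esym (restr_norm (st_str R) (ind_unit_pullback f) u).
Qed.

Lemma unit_nm (X Y : gset hT) (f : gmap X Y) (u : R X) :
  unit_fun (nm f u) = sN_nm (imap f) (unit_fun u).
Proof.
rewrite /unit_fun (sN_nmE _ (gid_distributor (imap f))) rmap_id rs_id.
rewrite -!nm_comp; congr (sN_cl (SNPre _ (nm _ u))).
by apply: gmap_eq => x; apply: esym (imapE f 1 x).
Qed.

(** With [b (eta x)] the point of [B] over [eta (f x)] given by [x], the
coinduced set [D_H(B, h, G x_H Y)] is [G x_H X]. *)
Lemma unit_dh_spec (X Y A B : gset hT) (f : gmap X Y) (f' : gmap A X)
    (g : gmap A B) (h : gmap B (rset H (iset Y)))
    (b : gmap (rset H (iset X)) B) (a : gmap X A) :
  distr_spec f (ind_unit Y) f' g h -> (forall w, h (b w) = imap f w) ->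
  (forall x, f' (a x) = x) -> (forall x, g (a x) = b (ind_unit X x)) ->
  dh_spec h b (imap f).
Proof.
move=> dP hb f'a ga; split=> // [d d'|v s sE hs].
  have [k [x ->]] := icl_ex d; rewrite imapE => /esym/imap_lift[x' [-> fx']] eb.
  congr icl; have := eb k^-1; rewrite /= !ind_actE mulVg.
  rewrite -[icl 1 x]/(ind_unit X x) -[icl 1 x']/(ind_unit X x') -!ga => ega.
  by rewrite -(f'a x) -(f'a x') (ds_inj dP _ ega) // !f'a fx'.
have [k [y vE]] := icl_ex v.
have [|a0 [fa0 ga0]] := ds_ex dP (y := y) (b := s k^-1).
  by rewrite hs vE /= ind_actE mulVg.
exists (icl k (f' a0)); split=> [|c]; first by rewrite imapE fa0 vE.
have hbc : h (b (gact (g := iset X) c (icl k (f' a0)))) =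
    gact (g := iset Y) c v.
  by rewrite hb gmapE imapE fa0 vE.
apply: (ds_uniq dP) => [|a1 a2 ga1 ga2 ea]; first by rewrite hs.
(* Only the points over [eta_Y] carry information; there [c * k] is in [H]. *)
have := ds_sq dP a2; rewrite ga2 hs vE /= ind_actE => /icl_eq[m [ckE fa2]].
rewrite mul1g in ckE.
have a2E : a2 = gact m a0.
  apply: (ds_inj dP); first by rewrite !gmapE fa0.
  by rewrite ga2 gmapE ga0 -sE -ckE mulgK.
have a1E : a1 = a (gact m (f' a0)).
  apply: (ds_inj dP); first by rewrite f'a ea a2E !gmapE.
  by rewrite ga1 ga /= ind_actE ckE -icl_h mul1g.
by rewrite a1E a2E f'a gmapE.
Qed.

Lemma unit_tr (X Y : gset hT) (f : gmap X Y) (u : R X) :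
  unit_fun (tr f u) = sN_tr (imap f) (unit_fun u).
Proof.
have d := dprod_distributor f (ind_unit Y).
have dP := proj1 (is_distributorP _ _ _ _ _) d.
have pb := is_pullback_sym (ind_unit_pullback f).
have [//|b [a [hb f'a ga pba]]] := distr_map (r := gid X) dP pb.
rewrite /unit_fun sN_trE gcomp1 /nm (norm_trans (st_str R) d).
have /dh_specP dh := unit_dh_spec dP hb f'a ga.
rewrite (sN_cl_step (sN_gen (gid _) _ dh)) gcomp1l.
congr (sN_cl (SNPre _ _)).
rewrite /rs (restr_norm (st_str R) pba) -restr_comp.
rewrite (_ : gcomp _ a = gid X) ?restr_id //.
exact: gmap_eq.
Qed.

Definition unit_hom : st_hom R (res_st H (sN_st R)) :=
  @StHom _ R (res_st H (sN_st R)) unit_fun unit_rs unit_tr unit_nm.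

End Unit.

Lemma unit_nat (R S : semi_tambara hT) (phi : st_hom R S) :
  st_comp (unit_hom S) phi = st_comp (res_hom H (sN_hom phi)) (unit_hom R).
Proof.
apply: st_hom_eq => X u.
by rewrite /= /unit_fun sN_mapE st_fun_nm.
Qed.

(** The unit as a natural transformation. *)
Definition unit_trans :
    nattrans (idfunctor (sTamb hT)) (comp_functor (Res H) (sN H)) :=
  @NatTrans (sTamb hT) (sTamb hT) (idfunctor _) (comp_functor (Res H) (sN H))
    unit_hom unit_nat.

(** * The counit *)

Section Counit.
Variable R : semi_tambara gT.
Local Notation resR := (res_st H R).

(** The counit on representatives: [(j, u)] goes to [t_j n_(eps_V) u]. *)
Definition counit_pre (X : gset gT) (a : sN_pre resR X) : R X :=
  tr (sN_j a) (nm (R := R) (ind_counit H (sN_V a)) (sN_u a)).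

Lemma rs_nm_counit (V W : gset gT) (f : gmap V W) (u : resR (rset H W)) :
  rs f (nm (R := R) (ind_counit H W) u) =
  nm (R := R) (ind_counit H V) (rs (R := resR) (rmap H f) u).
Proof. exact: (restr_norm (st_str R) (ind_counit_pullback f)). Qed.

Lemma counit_pre_step (X : gset gT) (a b : sN_pre resR X) :
  sN_step a b -> counit_pre a = counit_pre b.
Proof.
case=> {a b} [V V' j _ u _ f fbij <- <-|V j W f w D e p d]; rewrite /counit_pre /=.
  by rewrite -rs_nm_counit tr_comp tr_rs_bij.
by rewrite tr_comp; congr (tr j _); apply: (norm_trans (st_str R) d).
Qed.

(** The counit on classes; its values are given by [counit_mapE]. *)
Definition counit_map (X : gset gT) : sN_ob resR X -> R X :=
  sN_lift (@counit_pre X).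

Lemma counit_mapE (X V : gset gT) (j : gmap V X) (u : resR (rset H V)) :
  counit_map (sN_cl (SNPre j u)) = tr j (nm (R := R) (ind_counit H V) u).
Proof. exact: sN_liftE (@counit_pre_step X) _. Qed.

Lemma counit_rs (X Y : gset gT) (f : gmap X Y) (c : sN_ob resR Y) :
  counit_map (sN_rs f c) = rs f (counit_map c).
Proof.
elim/sN_ind: c => V j u; have pb := fprod_pullback f j.
rewrite (sN_rsE _ pb) !counit_mapE -rs_nm_counit.
exact: esym (restr_trans (st_str R) pb _).
Qed.

Lemma counit_tr (X Y : gset gT) (f : gmap X Y) (c : sN_ob resR X) :
  counit_map (sN_tr f c) = tr f (counit_map c).
Proof. by elim/sN_ind: c => V j u; rewrite sN_trE !counit_mapE tr_comp. Qed.

Lemma counit_nm (X Y : gset gT) (f : gmap X Y) (c : sN_ob resR X) :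
  counit_map (sN_nm f c) = nm f (counit_map c).
Proof.
elim/sN_ind: c => V j u; have d := dprod_distributor j f.
rewrite (sN_nmE _ d) !counit_mapE [RHS](norm_trans (st_str R) d).
congr (tr _ _); rewrite -/(rs _ _) rs_nm_counit -/(nm _ _) -nm_comp.
have /is_pullbackP[sq _ _] := ind_counit_pullback (fp2 f (dp_proj j f)).
have -> : gcomp (fp2 f (dp_proj j f)) (ind_counit H _) =
  gcomp (ind_counit H _) (imap (rmap H (fp2 f (dp_proj j f)))).
  exact: gmap_eq.
by rewrite nm_comp.
Qed.

Definition counit_hom : st_hom (sN_st resR) R :=
  @StHom _ (sN_st resR) R counit_map counit_rs counit_tr counit_nm.

End Counit.

Lemma counit_nat (R S : semi_tambara gT) (phi : st_hom R S) :
  st_comp (counit_hom S) (sN_hom (res_hom H phi)) = st_comp phi (counit_hom R).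
Proof.
apply: st_hom_eq => X c; elim/sN_ind: c => V j u.
by rewrite /= sN_mapE !counit_mapE st_fun_tr st_fun_nm.
Qed.

(** The counit as a natural transformation. *)
Definition counit_trans :
    nattrans (comp_functor (sN H) (Res H)) (idfunctor (sTamb gT)) :=
  @NatTrans (sTamb gT) (sTamb gT) (comp_functor (sN H) (Res H)) (idfunctor _)
    counit_hom counit_nat.

(** * The triangle identities *)

Lemma counit_unit_norm (R : semi_tambara hT) :
  st_comp (counit_hom (sN_st R)) (sN_hom (unit_hom R)) = st_id (sN_st R).
Proof.
apply: st_hom_eq => X c; elim/sN_ind: c => V j u.
rewrite /= sN_mapE counit_mapE /= /unit_fun /tr /nm /=.
rewrite (sN_nmE _ (gid_distributor (ind_counit H V))) sN_trE gcomp1.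
rewrite rmap_id rs_id -/(nm _ _) -nm_comp.
rewrite (_ : gcomp _ _ = gid (rset H V)) ?nm_id //.
by apply: gmap_eq => v; apply: etrans (ind_counitE 1 v) (Defs.gact1 _).
Qed.

Lemma counit_unit_res (R : semi_tambara gT) :
  st_comp (res_hom H (counit_hom R)) (unit_hom (res_st H R)) =
  st_id (res_st H R).
Proof.
apply: st_hom_eq => X u; rewrite /= /unit_fun counit_mapE tr_id.
rewrite -[nm (ind_unit X) u]/(nm (R := R) (imap (ind_unit X)) u) -nm_comp.
rewrite (_ : gcomp _ _ = gid (iset X)) ?nm_id //.
apply: gmap_eq => w; have [g [x ->]] := icl_ex w.
by rewrite /= imap_funE counit_funE /= ind_actE mulg1.
Qed.

End Adjunction.

Theorem theorem7p12 (gT : finGroupType) (H : {group gT}) :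
  exists
    (eta : nattrans (idfunctor (sTamb (sub_gT H)))
                    (comp_functor (Res H) (sN H)))
    (eps : nattrans (comp_functor (sN H) (Res H))
                    (idfunctor (sTamb gT))),
    [/\ (forall (R : semi_tambara (sub_gT H)) (X : gset (sub_gT H)) (u : R X),
           (eta R : st_hom R (res_st H (sN_st R))) X u =
           sN_cl (SNPre (gid (iset X)) (nm (ind_unit X) u))),
        (forall (R : semi_tambara gT) (X V : gset gT) (j : gmap V X)
           (u : res_st H R (rset H V)),
           (eps R : st_hom (sN_st (res_st H R)) R) X
             (sN_cl (SNPre j u)) =
           tr j (nm (ind_counit H V) u))
      & is_adjunction eta eps].
Proof.
exists (unit_trans H), (counit_trans H); split=> // [R X V j u|].
  exact: counit_mapE.
by split; [apply: counit_unit_norm | apply: counit_unit_res].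
Qed.
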